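(* For all $k\geq 2$, $$\sum_{n\geq0}I^e_{2134\cdots k}(n)\,x^n=\sum_{j=0}^{k-3}\left(x^j\Bigl(1+x^2R^e_{k-1-j}(x^2)\,F_{k-j}(x)\Bigr)\prod_{i=k-j}^{k}R_i(-x^2)\right)+x^{k-2}R_2(x)\prod_{j=3}^{k}R_j(-x^2),$$ where $F_m(x)=\dfrac{1}{x\,U_m\!\left(\frac{1}{2x}\right)}\sum_{j=0}^{m-1}U_j\!\left(\frac{1}{2x}\right)$.
   Context: $2134\cdots k$ denotes the permutation $(2,1,3,4,\dots,k)$ of length $k$ (for $k=2$ it is $21$). For a pattern $\tau$, $I^e_\tau(n)$ is the number of even involutions $\pi\in\mathfrak{S}_n$ (i.e. $\pi=\pi^{-1}$ with an even number of inversions, an inversion being a pair $i<j$ with $\pi_i>\pi_j$) avoiding both $132$ and $\tau$ (avoiding meaning no subsequence order-isomorphic to the pattern); $I^e_\tau(0)=1$. $U_r$ is the Chebyshev polynomial of the second kind ($U_0=1$, $U_1(t)=2t$, $U_r(t)=2tU_{r-1}(t)-U_{r-2}(t)$). For $k\geq1$, $R_k(x)=\dfrac{U_{k-1}\left(\frac{1}{2\sqrt{x}}\right)}{\sqrt{x}\,U_k\left(\frac{1}{2\sqrt{x}}\right)}$ (rational in $x$; $R_1=1$, $R_k=1/(1-xR_{k-1})$), and $R^e_k(x)=\tfrac12(R_k(x)+R_k(-x))$. Identities are of power series in $x$. *)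

(* Defs.v *)
From HB Require Import structures.
From mathcomp Require Import all_boot all_order all_fingroup all_algebra.
Set Implicit Arguments.
Unset Strict Implicit.
Unset Printing Implicit Defensive.
Import GRing.Theory.
Local Open Scope ring_scope.

(* Permutations act on {0, ..., n-1}; a pattern is given by its one-line word,
   for which only the relative order of the letters matters. *)
Definition contains (n : nat) (tau : seq nat) (s : 'S_n) : bool :=
  [exists f : {ffun 'I_(size tau) -> 'I_n},
     [forall a : 'I_(size tau), forall b : 'I_(size tau), (a < b)%N ==> (f a < f b)%N]
  && [forall a : 'I_(size tau), forall b : 'I_(size tau),
        (s (f a) < s (f b))%N == (nth 0%N tau a < nth 0%N tau b)%N]].

Definition avoids (n : nat) (tau : seq nat) (s : 'S_n) : bool :=
  ~~ contains tau s.

Definition inversions (n : nat) (s : 'S_n) : {set 'I_n * 'I_n} :=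
  [set p : 'I_n * 'I_n | (p.1 < p.2)%N && (s p.2 < s p.1)%N].

Definition even_involution (n : nat) (s : 'S_n) : bool :=
  (s == s^-1)%g && ~~ odd #|inversions s|.

Definition pattern132 : seq nat := [:: 1; 3; 2]%N.

(* 2 1 3 4 ... k, of length k for k >= 2 *)
Definition pattern2134 (k : nat) : seq nat := [:: 2, 1 & iota 3 (k - 2)]%N.

Definition Ie (tau : seq nat) (n : nat) : nat :=
  #|[set s : 'S_n | [&& even_involution s, avoids pattern132 s & avoids tau s]]|.

Fixpoint chebU (A : nzRingType) (r : nat) (t : A) {struct r} : A :=
  if r is r1.+1 then
    if r1 is r2.+1 then 2%:R * t * chebU r1 t - chebU r2 t else 2%:R * t
  else 1.

Definition ratfun : Type := {fraction {poly rat}}.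
HB.instance Definition _ := GRing.Field.on ratfun.

Definition frac_of (p : {poly rat}) : ratfun := @FracField.tofrac {poly rat} p.

Definition varx : ratfun := frac_of 'X.

Definition const_ratfun (c : rat) : ratfun := frac_of c%:P.

Definition poly_at (p : {poly rat}) (y : ratfun) : ratfun :=
  (map_poly const_ratfun p).[y].

Definition numer (f : {fraction {poly rat}}) : {poly rat} :=
  (frac (generic_quotient.repr f)).1.
Definition denom (f : {fraction {poly rat}}) : {poly rat} :=
  (frac (generic_quotient.repr f)).2.

(* The rational function f(y); it does not depend on the fraction representing
   f as soon as y is not a constant (ratfun_atE and poly_at_neq0 below). *)
Definition ratfun_at (f y : ratfun) : ratfun :=
  poly_at (numer f) y / poly_at (denom f) y.

Fact const_ratfun_is_zmod_morphism : zmod_morphism const_ratfun.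
Proof. by move=> a b; rewrite /const_ratfun /frac_of polyCB tofracB. Qed.
HB.instance Definition _ :=
  GRing.isZmodMorphism.Build rat ratfun const_ratfun
    const_ratfun_is_zmod_morphism.

Fact const_ratfun_is_monoid_morphism : monoid_morphism const_ratfun.
Proof.
by split=> [|a b]; rewrite /const_ratfun /frac_of ?tofrac1 // polyCM tofracM.
Qed.
HB.instance Definition _ :=
  GRing.isMonoidMorphism.Build rat ratfun const_ratfun
    const_ratfun_is_monoid_morphism.

Lemma poly_atM p q y : poly_at (p * q) y = poly_at p y * poly_at q y.
Proof. by rewrite /poly_at rmorphM hornerM. Qed.

Lemma denom_neq0 f : denom f != 0.
Proof. exact: denom_ratioP. Qed.

Lemma frac_of_neq0 (p : {poly rat}) : p != 0 -> frac_of p != 0.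
Proof. by rewrite /frac_of tofrac_eq0. Qed.

Lemma frac_numden (f : ratfun) : f = frac_of (numer f) / frac_of (denom f).
Proof.
apply: (mulIf (frac_of_neq0 (denom_neq0 f))).
rewrite divfK ?frac_of_neq0 ?denom_neq0 // /frac_of.
rewrite -{1}[f]generic_quotient.reprK; unlock FracField.tofrac.
rewrite -[LHS]FracField.pi_mul; apply/generic_quotient.eqmodP.
rewrite /= FracField.equivfE /FracField.mulf /numer /denom.
rewrite !numden_Ratio ?(mulr1, oner_neq0, denom_ratioP) //.
by rewrite mulrC.
Qed.

Lemma ratfun_atE (p q : {poly rat}) (y : ratfun) :
  (forall g : {poly rat}, g != 0 -> poly_at g y != 0) -> q != 0 ->
  ratfun_at (frac_of p / frac_of q) y = poly_at p y / poly_at q y.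
Proof.
move=> y_tr q0; set f := frac_of p / _.
have := frac_numden f; rewrite /ratfun_at {1}/f => /eqP.
rewrite eqr_div ?frac_of_neq0 ?denom_neq0 //.
rewrite /frac_of -!tofracM tofrac_eq => /eqP e.
by apply/eqP; rewrite eqr_div ?y_tr ?denom_neq0 // -!poly_atM -e mulrC.
Qed.

Lemma poly_at_comp (p h : {poly rat}) :
  poly_at p (frac_of h) = frac_of (p \Po h).
Proof.
elim/poly_ind: p => [|p c IHp].
  by rewrite /poly_at rmorph0 horner0 comp_poly0 /frac_of tofrac0.
rewrite comp_polyD comp_polyM comp_polyX comp_polyC.
have -> : frac_of ((p \Po h) * h + c%:P) =
          frac_of (p \Po h) * frac_of h + const_ratfun c.
  by rewrite /frac_of tofracD tofracM.
rewrite -IHp /poly_at rmorphD rmorphM /= map_polyX map_polyC.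
by rewrite hornerMXaddC.
Qed.

Lemma poly_at_neq0 (g h : {poly rat}) :
  (1 < size h)%N -> g != 0 -> poly_at g (frac_of h) != 0.
Proof.
move=> h1 g0; rewrite poly_at_comp /frac_of tofrac_eq0.
by rewrite comp_poly_eq0.
Qed.

(* t^r U_r(1/(2t)), as a polynomial in t^2 *)
Fixpoint chebP (r : nat) : {poly rat} :=
  if r is r1.+1 then if r1 is r2.+1 then chebP r1 - 'X * chebP r2 else 1 else 1.

Lemma chebP_neq0 r : chebP r != 0.
Proof.
suff h : (chebP r).[0] = 1.
  by apply: contra_eq_neq h => ->; rewrite horner0 eq_sym oner_neq0.
have [] // : (chebP r).[0] = 1 /\ (chebP r.+1).[0] = 1.
elim: r => [|r [h0 h1]]; first by rewrite !hornerE.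
split=> //; rewrite -[RHS]h1 -[chebP r.+2]/(chebP r.+1 - 'X * chebP r).
by rewrite hornerD hornerN hornerM hornerX mul0r subr0.
Qed.

Lemma varx_neq0 : varx != 0.
Proof. by rewrite /varx /frac_of tofrac_eq0 polyX_eq0. Qed.

Lemma two_neq0 : 2%:R != 0 :> ratfun.
Proof.
have -> : 2%:R = const_ratfun 2%:R by rewrite rmorph_nat.
by rewrite fmorph_eq0.
Qed.

Lemma poly_at_chebP r :
  poly_at (chebP r) (varx ^+ 2) = varx ^+ r * chebU r (2%:R * varx)^-1.
Proof.
set t := (_ * _)^-1.
have h2 : 2%:R * t * varx = 1.
  by rewrite /t mulrAC divff // mulf_neq0 ?two_neq0 ?varx_neq0.
have [] // : poly_at (chebP r) (varx ^+ 2) = varx ^+ r * chebU r t /\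
   poly_at (chebP r.+1) (varx ^+ 2) = varx ^+ r.+1 * chebU r.+1 t.
elim: r => [|r [h0 h1]].
  rewrite /= /poly_at rmorph1 hornerC expr0 mulr1 expr1.
  by split=> //; rewrite mulrC h2.
split=> //.
have -> : poly_at (chebP r.+2) (varx ^+ 2) =
  poly_at (chebP r.+1) (varx ^+ 2) - varx ^+ 2 * poly_at (chebP r) (varx ^+ 2).
  rewrite /poly_at [chebP r.+2]/= rmorphB rmorphM /= map_polyX.
  by rewrite hornerD hornerN hornerM hornerX.
have -> : chebU r.+2 t = 2%:R * t * chebU r.+1 t - chebU r t by [].
rewrite h0 h1 mulrBr; congr (_ - _); last by rewrite mulrA -exprD.
by rewrite [varx ^+ r.+2]exprSr -[RHS]mulrA [varx * (_ * _)]mulrA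
           [varx * _]mulrC h2 mul1r.
Qed.

(* U_{m-1}(1/(2t)) / (t U_m(1/(2t))): this is R_m(x), written in the variable
   t standing for sqrt(x). *)
Definition R_sqrt (m : nat) : ratfun :=
  chebU m.-1 (2%:R * varx)^-1 / (varx * chebU m (2%:R * varx)^-1).

Lemma varx_sqr_neq0 (g : {poly rat}) : g != 0 -> poly_at g (varx ^+ 2) != 0.
Proof.
have -> : varx ^+ 2 = frac_of ('X^2) by rewrite /varx /frac_of -tofracXn.
by apply: poly_at_neq0; rewrite size_polyXn.
Qed.

Fact Rk_exists (m : nat) : exists R : ratfun,
  (0 < m)%N ==> (ratfun_at R (varx ^+ 2) == R_sqrt m).
Proof.
case: m => [|m]; first by exists 0.
exists (frac_of (chebP m) / frac_of (chebP m.+1)); apply/implyP => _.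
rewrite (ratfun_atE _ varx_sqr_neq0 (chebP_neq0 _)).
rewrite !poly_at_chebP /R_sqrt exprSr -[_ * varx * _]mulrA -mulf_div divff ?mul1r //.
by rewrite expf_neq0 // varx_neq0.
Qed.

(* R_m is the rational function of x with R_m(t^2) = R_sqrt m, for m >= 1;
   R_0 is arbitrary. Existence and uniqueness are Rk_exists and Rk_unique. *)
Definition Rk (m : nat) : ratfun := xchoose (Rk_exists m).

Lemma RkE (m : nat) : (0 < m)%N ->
  ratfun_at (Rk m) (varx ^+ 2) =
  chebU m.-1 (2%:R * varx)^-1 / (varx * chebU m (2%:R * varx)^-1).
Proof. by move=> m0; apply/eqP; exact: (implyP (xchooseP (Rk_exists m))). Qed.

Lemma Rk_unique (f g : ratfun) :
  ratfun_at f (varx ^+ 2) = ratfun_at g (varx ^+ 2) -> f = g.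
Proof.
move=> /eqP; rewrite /ratfun_at eqr_div ?varx_sqr_neq0 ?denom_neq0 //.
rewrite -!poly_atM -subr_eq0 => e.
rewrite (frac_numden f) (frac_numden g); apply/eqP.
rewrite eqr_div ?frac_of_neq0 ?denom_neq0 // /frac_of -!tofracM tofrac_eq.
rewrite -subr_eq0; apply: contraTT e => /varx_sqr_neq0.
by rewrite /poly_at rmorphB hornerD hornerN.
Qed.

Lemma Rk_chebP m : Rk m.+1 = frac_of (chebP m) / frac_of (chebP m.+1).
Proof.
apply: Rk_unique; rewrite RkE //.
rewrite (ratfun_atE _ varx_sqr_neq0 (chebP_neq0 _)).
rewrite !poly_at_chebP exprSr -[_ * varx * _]mulrA -mulf_div divff ?mul1r //.
by rewrite expf_neq0 // varx_neq0.
Qed.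

Lemma Rk1 : Rk 1 = 1.
Proof. by rewrite Rk_chebP /= divff // /frac_of tofrac_eq0 oner_neq0. Qed.

Lemma Rk_rec m : Rk m.+2 = (1 - varx * Rk m.+1)^-1.
Proof.
have n0 r : frac_of (chebP r) != 0 by rewrite /frac_of tofrac_eq0 chebP_neq0.
rewrite !Rk_chebP -[RHS]invrK invrK -[LHS]invf_div; congr (_^-1).
rewrite mulrA -[1](divff (n0 m.+1)) -mulrBl; congr (_ / _).
by rewrite /varx /frac_of -tofracM -tofracB.
Qed.

Definition Rke (m : nat) : ratfun :=
  2%:R^-1 * (Rk m + ratfun_at (Rk m) (- varx)).

Definition Fm (m : nat) : ratfun :=
  (varx * chebU m (2%:R * varx)^-1)^-1 *
  \sum_(0 <= j < m) chebU j (2%:R * varx)^-1.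

(* The power series sum_n a_n x^n is the expansion of f at 0: for a fraction
   p / q representing f, q * (sum_n a_n x^n) = p in Q[[x]]. *)
Definition is_gen_fun (a : nat -> rat) (f : ratfun) : Prop :=
  exists p q : {poly rat},
    [/\ q != 0, f = frac_of p / frac_of q
      & forall n, \sum_(i < n.+1) q`_i * a (n - i)%N = p`_n].

(* Main.v *)
Require Import Defs.
From mathcomp Require Import all_boot all_order all_fingroup all_algebra.
From mathcomp Require Import zify ring.
Set Implicit Arguments.
Unset Strict Implicit.
Unset Printing Implicit Defensive.
Import GRing.Theory.

(* A 132-avoiding permutation is (u + 1) - v, where + and - stand for direct
   and skew sums, and it avoids 2134...k iff u avoids 2134...(k-1) and v avoids
   2134...k. It is an involution iff v is empty and u is an involution, or
   v = g - (u^-1 + 1) with g an involution; in the second case the number of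
   inversions is congruent to inv(g) + |u| + 1 modulo 2. Counting involutions
   with weight s^inv, s = 1 or -1, gives series G_k with
   G_k = 1 + x G_(k-1) + s x^2 R_(k-1)(s x^2) G_k, and 1/2 (G_k^+ + G_k^-) counts
   the even ones. Unrolling the recursion satisfied by this mean in k gives the
   sum over j, and F_k is G_k^+. *)

Local Open Scope nat_scope.

(** * Words of permutations and their sums *)

(** The inversions of u and of u^-1 are equally many, so they cancel modulo 2, and the sign of (u +
    1) - g - (u^-1 + 1) depends on u only through its length. Hence u is counted without sign, by
    R_(k-1), and the two outer blocks, of total length 2(|u| + 1) and sign s^(|u| + 1), contribute s
    x^2 R_(k-1)(s x^2). Since R_k(y) = 1/(1 - y R_(k-1)(y)), solving for G_k gives G_k = (1 + x
    G_(k-1)) R_k(s x^2). The obstacle is that this last factor differs for the two signs, so the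
    mean of the two series satisfies no recursion of its own. Trading R_k(x^2) for R_k(-x^2) leaves
    one common factor, at the cost of a correction proportional to G_k^+; this is the origin of the
    term x^2 R^e_(k-1)(x^2) F_k(x). The combinatorics is done on words over the natural numbers,
    because sums and decompositions change the length, which is part of the type in ['S_n]. *)

Definition perm_word (w : seq nat) : bool := uniq w && all (gtn (size w)) w.

(** Pigeonhole: n distinct letters below n exhaust 0, ..., n-1. *)
Lemma mem_perm_word w i : perm_word w -> (i \in w) = (i < size w).
Proof.
move=> /andP[uw /allP lew].
have sub : {subset w <= iota 0 (size w)}.
  by move=> j /lew jw; rewrite mem_iota.
have [_ ->] := uniq_min_size uw sub (eq_leq (size_iota _ _)).
by rewrite mem_iota.
Qed.

Lemma perm_word_iota n w :
  perm_eq w (iota 0 n) = perm_word w && (size w == n).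
Proof.
apply/idP/andP => [e|[pw /eqP <-]].
  have sw : size w = n by rewrite (perm_size e) size_iota.
  rewrite sw eqxx /perm_word (perm_uniq e) iota_uniq sw; split => //=.
  by apply/allP => i; rewrite (perm_mem e) mem_iota.
apply: uniq_perm; rewrite ?iota_uniq //; first by case/andP: pw.
by move=> i; rewrite mem_perm_word // mem_iota.
Qed.

Lemma perm_word_perm_eq w : perm_word w -> perm_eq w (iota 0 (size w)).
Proof. by move=> pw; rewrite perm_word_iota pw eqxx. Qed.

Definition skew_sum (u v : seq nat) : seq nat := map (addn (size v)) u ++ v.

Definition add_max (u : seq nat) : seq nat := rcons u (size u).

Definition node (u v : seq nat) : seq nat := skew_sum (add_max u) v.

Definition word_inv (w : seq nat) : seq nat :=
  [seq index i w | i <- iota 0 (size w)].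

Fixpoint word_inversions (w : seq nat) : nat :=
  if w is x :: w1 then count (gtn x) w1 + word_inversions w1 else 0.

Lemma size_skew_sum u v : size (skew_sum u v) = size u + size v.
Proof. by rewrite size_cat size_map. Qed.

Lemma size_add_max u : size (add_max u) = (size u).+1.
Proof. exact: size_rcons. Qed.

Lemma size_node u v : size (node u v) = (size u + size v).+1.
Proof. by rewrite size_skew_sum size_add_max. Qed.

Lemma size_word_inv w : size (word_inv w) = size w.
Proof. by rewrite size_map size_iota. Qed.

Lemma skew_sumA u v w : skew_sum u (skew_sum v w) = skew_sum (skew_sum u v) w.
Proof.
rewrite {2 3}/skew_sum map_cat -catA -map_comp; congr (_ ++ _).
by rewrite size_skew_sum; apply: eq_map => i /=; lia.
Qed.

Lemma node_nil u : node u [::] = add_max u.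
Proof. by rewrite /node /skew_sum cats0; apply: map_id. Qed.

Lemma skew_sum_inj u v u' v' : size v = size v' -> skew_sum u v = skew_sum u' v' ->
  u = u' /\ v = v'.
Proof.
move=> sv e; have su : size u = size u'.
  by move/(congr1 size): e; rewrite !size_skew_sum sv => /addIn.
move/eqP: e; rewrite /skew_sum eqseq_cat ?size_map // sv.
by case/andP => /eqP/(inj_map (@addnI _)) -> /eqP.
Qed.

Lemma perm_word_skew_sum u v : perm_word u -> perm_word v -> perm_word (skew_sum u v).
Proof.
move=> /andP[uu /allP lu] /andP[uv /allP lv]; apply/andP; split.
  rewrite cat_uniq (map_inj_uniq (@addnI _)) uu uv andbT /=.
  by apply/hasPn => i /lv /=; apply: contraTN => /mapP[j _ ->]; lia.
apply/allP => i; rewrite mem_cat size_skew_sum => /orP[/mapP[j /lu /= ju ->]|/lv /=]; lia.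
Qed.

Lemma perm_word_add_max u : perm_word (add_max u) = perm_word u.
Proof.
rewrite /perm_word /add_max rcons_uniq size_rcons all_rcons /= ltnSn /=.
apply/andP/andP => [[/andP[nu ->] /allP lu]|[-> /allP lu]]; split=> //.
- apply/allP => i iu /=; have := lu _ iu; rewrite /= ltnS leq_eqVlt.
  by case/orP => // /eqP e; rewrite e in iu; rewrite iu in nu.
- by rewrite andbT; apply/negP => /lu /=; rewrite ltnn.
by apply/allP => i /lu /=; apply: ltnW.
Qed.

Lemma perm_word_node u v : perm_word u -> perm_word v -> perm_word (node u v).
Proof. by move=> pu; apply: perm_word_skew_sum; rewrite perm_word_add_max. Qed.

(** A letter at most some b in [B] cannot lie in [A], whose letters all exceed b. So the letters of
    [B] are closed downwards and form an initial segment, and those of [A] are the rest, shifted by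
    [size B]. *)
Lemma perm_word_skew_sumP A B : perm_word (A ++ B) -> allrel gtn A B ->
  perm_word B /\ exists2 A', perm_word A' & A = map (addn (size B)) A'.
Proof.
move=> pAB /allrelP gAB; have [uAB lAB] := andP pAB.
have [uA dAB uB] : [/\ uniq A, ~~ has (mem A) B & uniq B].
  by apply/and3P; rewrite -cat_uniq.
have lB b : b \in B -> b < size B.
  move=> bB; rewrite -[X in X <= _](size_iota 0); apply: uniq_leq_size.
    exact: iota_uniq.
  move=> i; rewrite mem_iota /= add0n ltnS => lib.
  have : i \in A ++ B.
    rewrite mem_perm_word //; apply: leq_ltn_trans lib _.
    by rewrite -mem_perm_word // mem_cat bB orbT.
  rewrite mem_cat => /orP[iA|//].
  by have := gAB _ _ iA bB; rewrite /= ltnNge lib.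
have pB : perm_word B by rewrite /perm_word uB; apply/allP => i /lB.
split=> //; exists (map (subn^~ (size B)) A).
  have geA a : a \in A -> size B <= a.
    move=> aA; rewrite leqNgt -mem_perm_word //; apply/negP => aB.
    by have := gAB _ _ aA aB; rewrite /= ltnn.
  rewrite /perm_word map_inj_in_uniq ?uA /=.
    apply/allP => i /mapP[a aA ->]; rewrite size_map /=.
    have := geA _ aA; have : a < size (A ++ B).
      by rewrite -mem_perm_word // mem_cat aA.
    rewrite size_cat; lia.
  by move=> a b /geA ha /geA hb; lia.
rewrite -map_comp -[LHS]map_id; apply/eq_in_map => a aA /=.
rewrite subnKC // leqNgt -mem_perm_word //; apply/negP => aB.
by have := gAB _ _ aA aB; rewrite /= ltnn.
Qed.

(** The maximum occurs once and marks the place where the word splits, so that, unlike in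
    [skew_sum_inj], the sizes of the summands need not be known to agree. *)
Lemma node_inj u v u' v' :
    perm_word u -> perm_word v -> perm_word u' -> perm_word v' ->
  node u v = node u' v' -> u = u' /\ v = v'.
Proof.
move=> pu pv pu' pv' e.
have es : size v + size u = size v' + size u'.
  by move/(congr1 size): e; rewrite !size_node; lia.
have h x y : perm_word x -> perm_word y ->
    node x y = map (addn (size y)) x ++ (size y + size x) :: y /\
    size y + size x \notin map (addn (size y)) x.
  move=> px py; rewrite /node /skew_sum map_rcons cat_rcons; split=> //.
  apply/negP => /mapP[i]; rewrite mem_perm_word //; lia.
have [e1 n1] := h _ _ pu pv; have [e2 n2] := h _ _ pu' pv'.
have /eqP := e; rewrite e1 e2 -es eqseq_pivot2l ?es // -?es //.
case/andP => /eqP e3 /eqP ev; rewrite ev in e3 *.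
by move: e3 => /(inj_map (@addnI _)) ->.
Qed.

(** The small letters are those of [v], and they sit after the first [size u] positions; the inverse
    lists their positions first, which exchanges the two blocks. *)
Lemma word_inv_skew_sum u v : perm_word u -> perm_word v ->
  word_inv (skew_sum u v) = skew_sum (word_inv v) (word_inv u).
Proof.
move=> pu pv; rewrite /word_inv size_skew_sum addnC iotaD map_cat /skew_sum.
rewrite !size_map size_iota add0n -map_comp; congr (_ ++ _).
  apply/eq_in_map => i; rewrite mem_iota /= add0n => iv.
  rewrite index_cat size_map; case: ifP => // /mapP[j _]; lia.
rewrite -[X in iota X _]addn0 iotaDl -map_comp; apply/eq_in_map => i.
rewrite mem_iota /= add0n => iu; rewrite index_cat mem_map; last exact: addnI.
by rewrite mem_perm_word // iu index_map //; exact: addnI.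
Qed.

Lemma word_inv_add_max u : perm_word u ->
  word_inv (add_max u) = add_max (word_inv u).
Proof.
move=> pu; rewrite /word_inv size_add_max -[(size u).+1]addn1 iotaD map_cat.
rewrite cats1 /add_max size_map size_iota; congr rcons.
  apply/eq_in_map => i; rewrite mem_iota -cats1 index_cat /= add0n => iu.
  by rewrite mem_perm_word // iu.
by rewrite -cats1 index_cat mem_perm_word // add0n ltnn /= eqxx addn0.
Qed.

Lemma word_inv_node u v : perm_word u -> perm_word v ->
  word_inv (node u v) = skew_sum (word_inv v) (add_max (word_inv u)).
Proof.
move=> pu pv; rewrite word_inv_skew_sum ?perm_word_add_max //.
by rewrite word_inv_add_max.
Qed.

Lemma perm_word_inv w : perm_word w -> perm_word (word_inv w).
Proof.
move=> pw; rewrite /perm_word map_inj_in_uniq ?iota_uniq /=.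
  apply/allP => i /mapP[j]; rewrite mem_iota size_word_inv /= => jw ->.
  by rewrite index_mem mem_perm_word.
move=> i j; rewrite !mem_iota /= !add0n -!(mem_perm_word _ pw) => iw jw e.
by rewrite -(nth_index 0 iw) e nth_index.
Qed.

Lemma nth_word_inv w i : i < size w -> nth 0 (word_inv w) i = index i w.
Proof. by move=> iw; rewrite (nth_map 0) ?size_iota // nth_iota. Qed.

Lemma word_invK w : perm_word w -> word_inv (word_inv w) = w.
Proof.
move=> pw; apply: (@eq_from_nth _ 0); rewrite !size_word_inv // => i iw.
have nw : nth 0 w i < size w by rewrite -mem_perm_word // mem_nth.
rewrite nth_word_inv ?size_word_inv //.
have {1}-> : i = nth 0 (word_inv w) (nth 0 w i).
  by rewrite nth_word_inv // index_uniq //; case/andP: pw.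
by rewrite index_uniq ?size_word_inv //; case/andP: (perm_word_inv pw).
Qed.

Lemma word_inv_iota n : word_inv (iota 0 n) = iota 0 n.
Proof.
rewrite /word_inv size_iota -[RHS]map_id; apply/eq_in_map => i.
rewrite mem_iota /= => lin; have {1}-> : i = nth 0 (iota 0 n) i.
  by rewrite nth_iota.
by rewrite index_uniq ?size_iota ?iota_uniq.
Qed.

Lemma word_inversions_cat A B :
  word_inversions (A ++ B) = word_inversions A + word_inversions B
    + \sum_(a <- A) count (gtn a) B.
Proof.
elim: A => [|a A IH] /=; first by rewrite big_nil addn0.
by rewrite big_cons IH count_cat; lia.
Qed.

Lemma word_inversions_map m A :
  word_inversions (map (addn m) A) = word_inversions A.
Proof.
elim: A => //= a A ->; congr (_ + _); rewrite count_map.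
by apply: eq_count => i /=; rewrite ltn_add2l.
Qed.

Lemma word_inversions_skew_sum u v : perm_word v ->
  word_inversions (skew_sum u v) =
    word_inversions u + word_inversions v + size u * size v.
Proof.
move=> /andP[_ /allP lv]; rewrite word_inversions_cat word_inversions_map.
congr (_ + _); rewrite big_map; rewrite mulnC -[size v](addn0).
elim: u => [|a u IH]; rewrite ?big_nil ?muln0 //= big_cons IH mulnS addn0.
congr (_ + _); apply/eqP; rewrite -all_count; apply/allP => i /lv /=; lia.
Qed.

Lemma word_inversions_add_max u : perm_word u ->
  word_inversions (add_max u) = word_inversions u.
Proof.
move=> /andP[_ /allP lu]; rewrite /add_max -cats1 word_inversions_cat /= addn0.
rewrite big_seq big1 ?addn0 // => i /lu /=; lia.
Qed.

Lemma word_inversions_iota m n : word_inversions (iota m n) = 0.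
Proof.
elim: n m => //= n IH m; rewrite IH addn0; apply/eqP.
rewrite -leqn0 leqNgt -has_count; apply/hasPn => i; rewrite mem_iota /=; lia.
Qed.

(** * Pattern avoidance in words *)

(** Quantifying over the finitely many masks makes occurrence a boolean; [occursP] restates it with
    subsequences. *)
Definition occurs (Q : pred (seq nat)) (w : seq nat) : bool :=
  [exists m : (size w).-tuple bool, Q (mask m w)].

Lemma occursP (Q : pred (seq nat)) (w : seq nat) :
  reflect (exists2 u, subseq u w & Q u) (occurs Q w).
Proof.
apply: (iffP existsP) => [[m Qm]|[u /subseqP[m sm ->] Qm]].
  by exists (mask m w) => //; apply: mask_subseq.
by exists (tcast sm (in_tuple m)); rewrite val_tcast.
Qed.

Lemma subseq_catP (u A B : seq nat) : subseq u (A ++ B) ->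
  exists u1 u2, [/\ u = u1 ++ u2, subseq u1 A & subseq u2 B].
Proof.
move=> /subseqP[m]; rewrite size_cat => sm ->.
exists (mask (take (size A) m) A), (mask (drop (size A) m) B).
split; try exact: mask_subseq.
by rewrite -mask_cat ?cat_take_drop // size_takel // sm leq_addr.
Qed.

Lemma subseq_rcons2 (x y : nat) (s t : seq nat) :
  subseq (rcons s x) (rcons t y) -> subseq s t.
Proof.
rewrite -subseq_rev !rev_rcons -[subseq s t]subseq_rev /=.
by case: eqP => // _; apply: subseq_trans; apply: subseq_cons.
Qed.

(* A pattern whose first letter is below its last cannot straddle the two parts
   of a skew sum. *)
Lemma occurs_skew_sum (Q : pred (seq nat)) u v :
    (forall t, Q t -> head 0 t < last 0 t) ->
    (forall m t, Q (map (addn m) t) = Q t) -> perm_word v ->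
  occurs Q (skew_sum u v) = occurs Q u || occurs Q v.
Proof.
move=> Qlt Qmap pv; apply/occursP/orP => [[t tuv Qt]|[]/occursP[t tu Qt]].
- have [t1 [t2 [e t1u t2v]]] := subseq_catP tuv.
  have := Qlt _ Qt.
  case: t1 t2 e t1u t2v => [|x t1] [|y t2] e t1u t2v; rewrite e //= => le_xy.
  + by right; apply/occursP; exists (y :: t2) => //; move: Qt; rewrite e.
  + left; apply/occursP; rewrite cats0 in e; move: Qt; rewrite e.
    by case/subseqP: t1u => m _ ->; rewrite -map_mask Qmap; exists (mask m u) => //; apply: mask_subseq.
  have /mapP[i _ xi] : x \in map (addn (size v)) u.
    by apply: (mem_subseq t1u); apply: mem_head.
  have : last x (t1 ++ y :: t2) \in v.
    by rewrite last_cat /=; apply: (mem_subseq t2v); apply: mem_last.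
  by rewrite mem_perm_word // => /(ltn_trans le_xy); rewrite xi ltnNge leq_addr.
- exists (map (addn (size v)) t); rewrite ?Qmap //.
  by apply: subseq_trans (prefix_subseq _ _); apply: map_subseq.
by exists t => //; apply: subseq_trans tu (suffix_subseq _ _).
Qed.

Definition is132 (u : seq nat) : bool :=
  if u is [:: x; y; z] then x < z < y else false.

(* Recognizes the pattern 2134...(m+2). *)
Definition is2134 (m : nat) (u : seq nat) : bool :=
  if u is x :: y :: l then [&& size l == m, y < x & path ltn x l] else false.

Lemma is132_map m t : is132 (map (addn m) t) = is132 t.
Proof. by case: t => [|x [|y [|z []]]] //=; rewrite !ltn_add2l. Qed.

Lemma is2134_map r m t : is2134 r (map (addn m) t) = is2134 r t.
Proof.
case: t => [|x [|y l]] //=; rewrite size_map ltn_add2l; congr [&& _, _ & _].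
by elim: l x => //= z l IH x; rewrite ltn_add2l IH.
Qed.

Lemma is132_lt t : is132 t -> head 0 t < last 0 t.
Proof. by case: t => [|x [|y [|z []]]] //= /andP[]. Qed.

(** Index 0, the pattern 21, fails this. Hence the recursions below are stated at [r.+1], with index
    0 as a separate base case. *)
Lemma is2134_lt r t : is2134 r.+1 t -> head 0 t < last 0 t.
Proof.
case: t => [|x [|y [|z l]]] //= /and3P[_ _ /andP[xz pz]].
elim: l x z xz pz => //= z' l IH x z xz /andP[zz' pl].
by apply: (IH x z') => //; apply: ltn_trans xz zz'.
Qed.

(** The appended maximum could only play the last letter of 132, but that letter must lie below the
    middle one. *)
Lemma occurs132_add_max u : perm_word u ->
  occurs is132 (add_max u) = occurs is132 u.
Proof.
move=> pu; apply/occursP/occursP => [[t]|[t tu Qt]]; last first.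
  by exists t => //; apply: subseq_trans tu (subseq_rcons _ _).
case: t => [|x [|y [|z []]]] // tu Qt; exists [:: x; y; z] => //.
have /mem_subseq/(_ y) := @subseq_rcons2 z (size u) [:: x; y] u tu.
rewrite !inE eqxx orbT mem_perm_word // => /(_ isT) yu.
move: tu; rewrite /add_max -cats1 => /subseq_catP[t1 [t2 [e t1u t2n]]].
case/lastP: t2 e t2n => [|t2 z']; first by rewrite cats0 => ->.
rewrite -rcons_cat -[[:: x; y; z]]/(rcons [:: x; y] z).
move=> /rcons_inj[_ ez] /mem_subseq/(_ z').
rewrite mem_rcons mem_head => /(_ isT); rewrite inE => /eqP zu.
by move: Qt yu => /andP[_]; rewrite ez zu; lia.
Qed.

(** Dropping the last letter of an occurrence leaves the pattern shortened by one inside [u];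
    conversely the appended maximum prolongs any occurrence in [u]. *)
Lemma occurs2134_add_max r u : perm_word u ->
  occurs (is2134 r.+1) (add_max u) = occurs (is2134 r) u.
Proof.
move=> pu; apply/occursP/occursP => [[t]|[t tu Qt]].
  case: t => [|x [|y l]] //= tu; case/lastP: l tu => [|l z] //= tu.
  rewrite size_rcons rcons_path => /and3P[sl yx /andP[pl _]].
  exists [:: x, y & l]; last by rewrite /= -eqSS sl yx.
  exact: (@subseq_rcons2 z (size u) [:: x, y & l] u tu).
exists (rcons t (size u)).
  by rewrite /add_max -!cats1 cat_subseq.
case: t tu Qt => [|x [|y l]] //= tu /and3P[sl yx pl].
rewrite size_rcons rcons_path eqSS sl yx pl /= -mem_perm_word //.
apply: (mem_subseq tu); have := mem_last x l; rewrite !inE.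
by case/orP => ->; rewrite ?orbT.
Qed.

(* The index r stands for the pattern 2134...(r+2). *)
Definition avoiding (r : nat) (w : seq nat) : bool :=
  ~~ occurs is132 w && ~~ occurs (is2134 r) w.

Lemma avoiding_skew_sum r u v : perm_word v ->
  avoiding r.+1 (skew_sum u v) = avoiding r.+1 u && avoiding r.+1 v.
Proof.
move=> pv; rewrite /avoiding !occurs_skew_sum //; first 1 last.
- exact: is2134_lt.
- exact: is2134_map.
- exact: is132_lt.
- exact: is132_map.
by rewrite !negb_or andbACA.
Qed.

Lemma avoiding_add_max r u : perm_word u ->
  avoiding r.+1 (add_max u) = avoiding r u.
Proof.
by move=> pu; rewrite /avoiding occurs132_add_max // occurs2134_add_max.
Qed.

Lemma avoiding_node r u v : perm_word u -> perm_word v ->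
  avoiding r.+1 (node u v) = avoiding r u && avoiding r.+1 v.
Proof. by move=> pu pv; rewrite avoiding_skew_sum // avoiding_add_max. Qed.

(** A word without 21 is sorted, hence the identity; conversely an increasing word also avoids 132,
    since that pattern has a descent. *)
Lemma avoiding0 w : perm_word w -> avoiding 0 w = (w == iota 0 (size w)).
Proof.
move=> pw; apply/idP/eqP => [/andP[_ no]|->].
  apply: (sorted_eq leq_trans anti_leq); rewrite ?iota_sorted //.
    rewrite (sorted_pairwise leq_trans); move: no {pw}.
    elim: w => //= x w IH no; apply/andP; split; last first.
      apply: IH; apply: contra no => /occursP[t tw Qt]; apply/occursP.
      by exists t => //; apply: subseq_trans tw (subseq_cons _ _).
    apply/allP => y yw; rewrite leqNgt; apply: contra no => yx.
    by apply/occursP; exists [:: x; y]; rewrite /= ?eqxx ?yx // sub1seq.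
  exact: perm_word_perm_eq.
have sub t : subseq t (iota 0 (size w)) -> sorted ltn t.
  by move=> /(subseq_sorted ltn_trans); apply; apply: iota_ltn_sorted.
apply/andP; split; apply/occursP => -[[|x [|y t]] // /sub /=].
  by case: t => [|z []] //= /and3P[_ yz _] /andP[_]; rewrite ltnNge ltnW.
by case/andP => xy _ /and3P[_]; rewrite ltnNge ltnW.
Qed.

Lemma avoiding_nil r : avoiding r [::].
Proof. by apply/andP; split; apply/occursP => -[t /eqP->]. Qed.

(** The cut is made after the maximum n: if a stands before it, b after it and a < b, then a, n, b
    is an occurrence of 132. *)
Lemma nodeP w : perm_word w -> ~~ occurs is132 w -> w != [::] ->
  exists u v, [/\ perm_word u, perm_word v & w = node u v].
Proof.
move=> pw no; rewrite -size_eq0 -lt0n => w0.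
have [n en] : exists n, n.+1 = size w by exists (size w).-1; rewrite prednK.
have nw : n \in w by rewrite mem_perm_word // -en.
move: pw no w0 en; case/splitPr: nw => A B pw no _ en.
have ltn_mem i : i \in A ++ B -> i < n.
  move=> iAB; have := mem_perm_word i pw.
  rewrite mem_cat in_cons orbCA -mem_cat iAB orbT => /esym i_lt.
  rewrite ltn_neqAle -ltnS en i_lt andbT.
  case/andP: pw => /=; rewrite uniq_catC /= mem_cat orbC -mem_cat.
  by case/andP => nAB _ _; apply: contraNneq nAB => <-.
have gAB : allrel gtn (rcons A n) B.
  apply/allrelP => a b; rewrite mem_rcons inE => /orP[/eqP->|aA] bB.
    by rewrite /= ltn_mem // mem_cat bB orbT.
  rewrite /= ltnNge leq_eqVlt negb_or; apply/andP; split.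
    case/andP: pw; rewrite cat_uniq => /and3P[_ /hasPn d _] _.
    by apply: contraTneq aA => ->; apply: (d b); rewrite inE bB orbT.
  apply: contra no => ab; apply/occursP; exists [:: a; n; b].
    by rewrite -[_ :: _]/([:: a] ++ [:: n; b]) cat_subseq //= ?eqxx ?sub1seq.
  by rewrite /= ab ltn_mem // mem_cat bB orbT.
have [|pB [A' pA' eA]] := perm_word_skew_sumP _ gAB; first by rewrite cat_rcons.
case/lastP: A' pA' eA => [|A' z] pA' eA.
  by move/(congr1 size): eA; rewrite size_rcons.
exists A', B; rewrite /node /skew_sum.
suff ez : z = size A'.
  rewrite ez in pA' eA; split=> //; last by rewrite -cat_rcons eA.
  by rewrite -perm_word_add_max.
move: eA; rewrite map_rcons => /rcons_inj[/(congr1 size)].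
rewrite size_map => sA; move: en; rewrite size_cat /= sA; lia.
Qed.

(** Inversion turns a node into the skew sum of the inverted blocks in the opposite order, and both
    avoidance and the number of inversions are insensitive to the order of the blocks. The induction
    on length keeps [r] general, because the block [u] lives at index [r] when the word lives at
    [r.+1]. *)
Lemma word_inv_avoiding r w : perm_word w -> avoiding r w ->
  avoiding r (word_inv w) /\ word_inversions (word_inv w) = word_inversions w.
Proof.
have [n] := ubnP (size w); elim: n => // n IH in r w * => sw pw.
case: r => [|r] avw.
  by move: (avw); rewrite avoiding0 // => /eqP e; rewrite e word_inv_iota -e.
have [->|w0] := eqVneq w [::]; first by rewrite avoiding_nil.
have [u [v [pu pv e]]] := nodeP pw (proj1 (andP avw)) w0.
move: avw sw; rewrite e avoiding_node // size_node => /andP[au av] sw.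
have [|au' iu] := IH r u _ pu au; first by lia.
have [|av' iv] := IH r.+1 v _ pv av; first by lia.
have [pu' pv'] := (perm_word_inv pu, perm_word_inv pv).
rewrite word_inv_node // avoiding_skew_sum ?perm_word_add_max //.
rewrite avoiding_add_max // av' au' /node !word_inversions_skew_sum //.
  rewrite !word_inversions_add_max // iu iv !size_add_max !size_word_inv.
  by split=> //; lia.
by rewrite perm_word_add_max.
Qed.

(** * The decomposition of involutions *)

Definition sym_node (u g : seq nat) : seq nat :=
  node u (skew_sum g (add_max (word_inv u))).

Lemma size_sym_node u g : size (sym_node u g) = (size u).+1.*2 + size g.
Proof. by rewrite size_node size_skew_sum size_add_max size_word_inv; lia. Qed.

Lemma sym_node_inj u g u' g' :
    perm_word u -> perm_word g -> perm_word u' -> perm_word g' ->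
  sym_node u g = sym_node u' g' -> u = u' /\ g = g'.
Proof.
move=> pu pg pu' pg' /node_inj[] //; try apply: perm_word_skew_sum => //;
  rewrite ?perm_word_add_max ?perm_word_inv // => <-.
by case/skew_sum_inj.
Qed.

Lemma perm_word_sym_node u g : perm_word u -> perm_word g -> perm_word (sym_node u g).
Proof.
move=> pu pg; apply: perm_word_node => //; apply: perm_word_skew_sum => //.
by rewrite perm_word_add_max perm_word_inv.
Qed.

(** Inversion reverses the order of the three blocks; the outer two are inverse to each other, so
    they trade places and only the middle one changes. *)
Lemma word_inv_sym_node u g : perm_word u -> perm_word g ->
  word_inv (sym_node u g) = sym_node u (word_inv g).
Proof.
move=> pu pg; have pu' := perm_word_inv pu.
rewrite word_inv_node //; last by rewrite perm_word_skew_sum ?perm_word_add_max.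
rewrite word_inv_skew_sum ?perm_word_add_max //.
by rewrite word_inv_add_max // word_invK // -skew_sumA.
Qed.

(** The third block imposes no new condition, since avoidance is closed under inverses. *)
Lemma avoiding_sym_node r u g : perm_word u -> perm_word g ->
  avoiding r.+1 (sym_node u g) = avoiding r u && avoiding r.+1 g.
Proof.
move=> pu pg; have pu' := perm_word_inv pu.
rewrite avoiding_node //; last by rewrite perm_word_skew_sum ?perm_word_add_max.
case au: (avoiding r u) => //=.
rewrite avoiding_skew_sum ?perm_word_add_max // avoiding_add_max //.
by case: (word_inv_avoiding pu au) => ->; rewrite andbT.
Qed.

(** Letters of different blocks always form an inversion: each outer block meets [g] in
    [(size u).+1 * size g] pairs, and the outer blocks meet each other in [(size u).+1] squared. All
    the rest except the inversions of [g] comes in two equal copies. *)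
Lemma word_inversions_sym_node r u g : perm_word u -> perm_word g -> avoiding r u ->
  word_inversions (sym_node u g) = word_inversions g
    + (word_inversions u + (size u).+1 * size g).*2 + (size u).+1 * (size u).+1.
Proof.
move=> pu pg au; have pu' := perm_word_inv pu.
rewrite word_inversions_skew_sum; last by rewrite perm_word_skew_sum ?perm_word_add_max.
rewrite word_inversions_skew_sum ?perm_word_add_max //.
rewrite size_skew_sum !word_inversions_add_max // !size_add_max size_word_inv.
by case: (word_inv_avoiding pu au) => _ ->; nia.
Qed.

(* In (v^-1) - (u^-1 + 1) = (u + 1) - v the final block u^-1 + 1 must be a suffix
   of v, because the maximum on the right does not fit into that block. *)
Lemma involution_nodeP u v : perm_word u -> perm_word v ->
    word_inv (node u v) = node u v ->
  v = [::] /\ word_inv u = u \/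
  exists g, [/\ perm_word g, word_inv g = g & node u v = sym_node u g].
Proof.
move=> pu pv; have pu' := perm_word_inv pu; have pv' := perm_word_inv pv.
rewrite word_inv_node // /node => e.
have [v0|v_neq0] := eqVneq v [::].
  left; split=> //; move: e; rewrite v0 /skew_sum /= cats0 map_id_in //.
  by move=> /rcons_inj[].
right; have [lt_vu|le_uv] := ltnP (size v) (size u).+1.
  have : nth 0 (skew_sum (add_max u) v) (size u) = size v + size u.
    rewrite nth_cat size_map size_add_max ltnSn.
    by rewrite (nth_map 0) ?size_add_max // nth_rcons ltnn eqxx.
  rewrite -e nth_cat size_map size_word_inv ltnNge -ltnS lt_vu /= => e1.
  have : nth 0 (add_max (word_inv u)) (size u - size v) < (size u).+1.
    rewrite -[X in _ < X.+1](size_word_inv u) -size_add_max.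
    rewrite -mem_perm_word ?perm_word_add_max // mem_nth //.
    by rewrite size_add_max size_word_inv; lia.
  have v_gt0 : 0 < size v by rewrite lt0n size_eq0.
  by rewrite e1 => lt_u; exfalso; clear -v_gt0 lt_u; lia.
have [A [B [ev0 sB]]] : exists A B, v = A ++ B /\ size B = (size u).+1.
  exists (take (size v - (size u).+1) v), (drop (size v - (size u).+1) v).
  by rewrite cat_take_drop size_drop subKn.
have : map (addn (size u).+1) (word_inv v) ++ add_max (word_inv u)
    == (map (addn (size v)) (add_max u) ++ A) ++ B.
  rewrite -catA -ev0; apply/eqP; rewrite -[RHS]e.
  by rewrite /skew_sum size_add_max size_word_inv.
rewrite eqseq_cat; last first.
  by rewrite size_cat !size_map size_iota size_add_max ev0 size_cat sB addnC.
case/andP => /eqP eA' /eqP eB; have ev : v = A ++ add_max (word_inv u).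
  by rewrite eB.
have [| |pB [g pg eA]] := @perm_word_skew_sumP A (add_max (word_inv u)).
- by rewrite -ev.
- apply/allrelP => a b aA; rewrite mem_perm_word ?perm_word_add_max //.
  rewrite size_add_max size_word_inv => bu.
  have /mapP[i _ ->] : a \in map (addn (size u).+1) (word_inv v).
    by rewrite eA' mem_cat aA orbT.
  by rewrite /=; lia.
have evg : v = skew_sum g (add_max (word_inv u)) by rewrite ev eA.
have es : node u v = sym_node u g by rewrite /sym_node -evg.
exists g; split=> //.
have : sym_node u (word_inv g) = sym_node u g.
  by rewrite -word_inv_sym_node // -es word_inv_node.
by case/sym_node_inj => //; apply: perm_word_inv.
Qed.

(** * Enumeration of avoiders and involutions *)

Definition avoiders (r n : nat) : seq (seq nat) :=
  [seq w <- permutations (iota 0 n) | avoiding r w].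

Definition involutions (r n : nat) : seq (seq nat) :=
  [seq w <- avoiders r n | word_inv w == w].

Lemma mem_avoiders r n w :
  (w \in avoiders r n) = [&& perm_word w, size w == n & avoiding r w].
Proof.
by rewrite mem_filter mem_permutations perm_word_iota andbC andbA.
Qed.

Lemma mem_involutions r n w : (w \in involutions r n) =
  [&& perm_word w, size w == n, avoiding r w & word_inv w == w].
Proof. by rewrite mem_filter mem_avoiders andbC -!andbA. Qed.

Lemma avoiders_uniq r n : uniq (avoiders r n).
Proof. by rewrite filter_uniq // permutations_uniq. Qed.

Lemma involutions_uniq r n : uniq (involutions r n).
Proof. by rewrite filter_uniq // avoiders_uniq. Qed.

Lemma avoiders0 n : perm_eq (avoiders 0 n) [:: iota 0 n].
Proof.
apply: uniq_perm; rewrite ?avoiders_uniq // => w.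
rewrite mem_avoiders inE; apply/and3P/eqP => [[pw /eqP <-]|->].
  by rewrite avoiding0 // => /eqP.
have /andP[pn _] : perm_word (iota 0 n) && (size (iota 0 n) == n).
  by rewrite -perm_word_iota.
by rewrite avoiding0 // size_iota.
Qed.

Lemma involutions0 n : perm_eq (involutions 0 n) [:: iota 0 n].
Proof.
rewrite (perm_trans (perm_filter _ (avoiders0 n))) //=.
by rewrite word_inv_iota eqxx.
Qed.

Lemma avoidersS0 r : avoiders r 0 = [:: [::]].
Proof. by rewrite /avoiders /= avoiding_nil. Qed.

Lemma involutionsS0 r : involutions r 0 = [:: [::]].
Proof. by rewrite /involutions avoidersS0. Qed.

(** Common shape of the two decompositions: [i] is the size of the first factor, and it determines
    the size of the second. *)
Definition assemble (f : seq nat -> seq nat -> seq nat) (I : seq nat)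
    (S T : nat -> seq (seq nat)) : seq (seq nat) :=
  [seq f p.1 p.2 | i <- I, p <- [seq (u, v) | u <- S i, v <- T i]].

Lemma assembleP f I S T w : (forall i u, u \in S i -> size u = i) ->
  reflect (exists u v, [/\ size u \in I, u \in S (size u),
                           v \in T (size u) & w = f u v])
          (w \in assemble f I S T).
Proof.
move=> sS; apply: (iffP allpairsPdep) => [[i [p [iI pi ->]]]|[u [v [uI uS vT ->]]]].
  case/allpairsP: pi iI => -[u v] /= [uS vT ->] iI.
  by exists u, v; rewrite (sS _ _ uS).
by exists (size u), (u, v); split=> //; apply: allpairs_f.
Qed.

(** The first factor is recovered from the assembled word and its size is the index, so different
    indices give disjoint lists. *)
Lemma assemble_uniq f I S T :
    (forall i u, u \in S i -> size u = i) -> uniq I ->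
    (forall i, uniq (S i)) -> (forall i, uniq (T i)) ->
    (forall i j u v u' v', u \in S i -> v \in T i -> u' \in S j -> v' \in T j ->
      f u v = f u' v' -> u = u' /\ v = v') ->
  uniq (assemble f I S T).
Proof.
move=> sS + uS uT inj; elim: I => //= i I IH /andP[iI uI].
rewrite cat_uniq; apply/and3P; split; last exact: IH.
  rewrite map_inj_in_uniq.
    by apply: allpairs_uniq => // -[u v] [u' v'] _ _ /=.
  move=> p q /allpairsP[[u v] /= [uS1 vT1 ->]] /allpairsP[[u' v'] /= [uS2 vT2 ->]].
  by case/(inj _ _ _ _ _ _ uS1 vT1 uS2 vT2) => -> ->.
apply/hasPn => w /(assembleP _ _ _ _ sS)[u [v [uI1 uS1 vT1 ->]]].
apply: contra iI => /mapP[p /allpairsP[[u' v'] /= [uS2 vT2 ->]]].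
by case/(inj _ _ _ _ _ _ uS1 vT1 uS2 vT2) => e _; rewrite -(sS _ _ uS2) -e.
Qed.

Lemma size_avoiders_mem r i u : u \in avoiders r i -> size u = i.
Proof. by rewrite mem_avoiders => /and3P[_ /eqP]. Qed.

Lemma avoiders_rec r n : perm_eq (avoiders r.+1 n.+1)
  (assemble node (iota 0 n.+1) (avoiders r) (fun i => avoiders r.+1 (n - i))).
Proof.
apply: uniq_perm; first exact: avoiders_uniq.
  apply: assemble_uniq => [i u|||i|i j u v u' v'].
  - exact: size_avoiders_mem.
  - exact: iota_uniq.
  - exact: avoiders_uniq.
  - exact: avoiders_uniq.
  rewrite !mem_avoiders => /and3P[pu _ _] /and3P[pv _ _] /and3P[pu' _ _].
  by case/and3P => pv' _ _; apply: node_inj.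
move=> w; apply/idP/(assembleP _ _ _ _ (@size_avoiders_mem r)); last first.
  case=> u [v []]; rewrite !mem_avoiders mem_iota => lin /and3P[pu _ au].
  case/and3P=> pv /eqP sv av ->.
  by rewrite perm_word_node // size_node avoiding_node // au av andbT /= sv; lia.
rewrite mem_avoiders => /and3P[pw /eqP sw aw].
have w0 : w != [::] by rewrite -size_eq0 sw.
have [u [v [pu pv e]]] := nodeP pw (proj1 (andP aw)) w0.
move: aw sw; rewrite e avoiding_node // size_node => /andP[au av] [suv].
by exists u, v; rewrite mem_iota !mem_avoiders pu pv au av; split=> //=; lia.
Qed.

(** The outer blocks of a [sym_node] use 2(i + 1) letters, where i is the size of [u]; this must not
    exceed [n.+1], which gives the range of i. The two lists are disjoint because the part after the
    maximum is empty in the first and nonempty in the second. *)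
Lemma involutions_rec r n : perm_eq (involutions r.+1 n.+1)
  (map add_max (involutions r n) ++
   assemble sym_node (iota 0 n.+1./2) (avoiders r)
     (fun i => involutions r.+1 (n.+1 - i.+1.*2))).
Proof.
apply: uniq_perm; first exact: involutions_uniq.
  rewrite cat_uniq map_inj_in_uniq ?involutions_uniq //=; last first.
    move=> u v; rewrite !mem_involutions => /and4P[pu _ _ _] /and4P[pv _ _ _].
    by rewrite -!node_nil => /node_inj[].
  apply/andP; split.
    apply/hasPn => w /(assembleP _ _ _ _ (@size_avoiders_mem r))[u [v []]].
    rewrite mem_avoiders mem_involutions => _ /and3P[pu _ _] /andP[pv _] ->.
    apply/negP => /mapP[w']; rewrite mem_involutions => /and4P[pw' _ _ _].
    rewrite -node_nil => /node_inj[] //.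
      by rewrite perm_word_skew_sum // perm_word_add_max perm_word_inv.
    by move=> _ /(congr1 size); rewrite size_skew_sum size_add_max addnS.
  apply: assemble_uniq => [i u|||i|i j u v u' v'].
  - exact: size_avoiders_mem.
  - exact: iota_uniq.
  - exact: avoiders_uniq.
  - exact: involutions_uniq.
  rewrite !mem_avoiders !mem_involutions.
  move=> /and3P[pu _ _] /andP[pv _] /and3P[pu' _ _] /andP[pv' _].
  exact: sym_node_inj.
move=> w; rewrite mem_cat; apply/idP/orP; last first.
  case=> [/mapP[u]|/(assembleP _ _ _ _ (@size_avoiders_mem r))[u [v []]]].
    rewrite !mem_involutions => /and4P[pu /eqP su au /eqP iu] ->.
    rewrite perm_word_add_max pu size_add_max su avoiding_add_max // au.
    by rewrite word_inv_add_max // iu !eqxx.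
  rewrite mem_avoiders !mem_involutions mem_iota => lin /and3P[pu _ au].
  move=> /and4P[pv /eqP sv av /eqP iv] ->.
  rewrite perm_word_sym_node // size_sym_node avoiding_sym_node // au av.
  by rewrite word_inv_sym_node // iv eqxx andbT /= sv; lia.
rewrite mem_involutions => /and4P[pw /eqP sw aw /eqP iw].
have w0 : w != [::] by rewrite -size_eq0 sw.
have [u [v [pu pv e]]] := nodeP pw (proj1 (andP aw)) w0.
rewrite e in iw aw sw *.
have [[v0 iu]|[g [pg ig es]]] := involution_nodeP pu pv iw.
  left; apply/mapP; exists u; last by rewrite v0 node_nil.
  rewrite mem_involutions pu iu eqxx andbT; move: aw sw.
  by rewrite avoiding_node // size_node v0 addn0 => /andP[-> _] [->]; rewrite eqxx.
right; apply/(assembleP _ _ _ _ (@size_avoiders_mem r)).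
move: aw sw; rewrite es avoiding_sym_node // size_sym_node => /andP[au ag] sug.
exists u, g; rewrite mem_iota mem_avoiders mem_involutions.
by rewrite pu pg au ag ig !eqxx; split=> //=; lia.
Qed.

(** * Permutations as words *)

Definition word (n : nat) (s : 'S_n) : seq nat := [seq val (s i) | i <- enum 'I_n].

Lemma size_word n (s : 'S_n) : size (word s) = n.
Proof. by rewrite size_map size_enum_ord. Qed.

Lemma nth_word n (s : 'S_n) (i : 'I_n) : nth 0 (word s) i = s i.
Proof. by rewrite (nth_map i) ?size_enum_ord // nth_ord_enum. Qed.

Lemma perm_word_word n (s : 'S_n) : perm_word (word s).
Proof.
rewrite /perm_word map_inj_uniq ?enum_uniq /=; last first.
  by move=> i j /val_inj/perm_inj.
by apply/allP => i /mapP[j _ ->]; rewrite size_word /=.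
Qed.

Lemma word_injective n : injective (@word n).
Proof.
by move=> s t e; apply/permP => i; apply: ord_inj; rewrite -!nth_word e.
Qed.

Lemma word_surjective n w : perm_word w -> size w = n ->
  exists s : 'S_n, word s = w.
Proof.
move=> pw sw.
have lt_w (i : 'I_n) : nth 0 w i < n.
  by rewrite -{2}sw -mem_perm_word // mem_nth // sw.
have inj : injective (fun i => Ordinal (lt_w i)).
  move=> i j [] /eqP; rewrite nth_uniq ?sw //; last by case/andP: pw.
  by move/eqP/val_inj.
exists (perm inj); apply: (@eq_from_nth _ 0); rewrite size_word ?sw // => i lin.
by rewrite (nth_word _ (Ordinal lin)) permE.
Qed.

Lemma word_permV n (s : 'S_n) : word s^-1%g = word_inv (word s).
Proof.
apply: (@eq_from_nth _ 0); rewrite size_word ?size_word_inv ?size_word // => i lin.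
rewrite nth_word_inv ?size_word // (nth_word _ (Ordinal lin)).
have {2}<- : nth 0 (word s) (s^-1%g (Ordinal lin)) = i by rewrite nth_word permKV.
by rewrite index_uniq ?size_word //; case/andP: (perm_word_word s).
Qed.

Lemma word_inversionsE w : word_inversions w =
  \sum_(0 <= i < size w) \sum_(0 <= j < size w)
    ((i < j) && (nth 0 w j < nth 0 w i)).
Proof.
elim: w => [|x w IH] /=; first by rewrite big_nil.
rewrite big_nat_recl //; congr (_ + _).
  rewrite big_nat_recl //= add0n -sum1_count (big_nth 0) big_mkcond.
  by apply: eq_bigr => j _ /=; case: ifP.
by rewrite IH; apply: eq_bigr => i _; rewrite [RHS]big_nat_recl.
Qed.

Lemma card_inversions n (s : 'S_n) : #|inversions s| = word_inversions (word s).
Proof.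
rewrite word_inversionsE size_word big_mkord -sum1_card big_mkcond /=.
rewrite [RHS](eq_bigr (fun i : 'I_n => \sum_(j < n) ((i < j) && (s j < s i)))).
  rewrite pair_bigA; apply: eq_bigr => p _; rewrite inE.
  by case: (_ && _).
by move=> i _; rewrite big_mkord; apply: eq_bigr => j _; rewrite !nth_word.
Qed.

(** * Pattern containment in permutations and in their words *)

Definition order_iso (tau u : seq nat) : bool :=
  (size u == size tau) &&
  [forall a : 'I_(size tau), forall b : 'I_(size tau),
     (nth 0 u a < nth 0 u b) == (nth 0 tau a < nth 0 tau b)].

Lemma ltn_ord_trans n : transitive (fun i j : 'I_n => i < j).
Proof. by move=> ? ? ?; apply: ltn_trans. Qed.

Lemma sorted_enum_ord n : sorted (fun i j : 'I_n => i < j) (enum 'I_n).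
Proof.
by have := iota_ltn_sorted 0 n; rewrite -val_enum_ord sorted_map.
Qed.

Lemma containsE n (tau : seq nat) (s : 'S_n) :
  contains tau s = occurs (order_iso tau) (word s).
Proof.
apply/existsP/occursP => [[f /andP[/forallP fi /forallP fo]]|[u]].
  pose l := [seq f a | a <- enum 'I_(size tau)].
  have sl : size l = size tau by rewrite size_map size_enum_ord.
  exists [seq val (s i) | i <- l].
    apply: map_subseq.
    (* Both lists are strictly increasing and have the same members, hence they are equal. *)
    suff -> : l = [seq i <- enum 'I_n | i \in l] by apply: filter_subseq.
    apply: (irr_sorted_eq (@ltn_ord_trans n)).
    - by move=> i; rewrite ltnn.
    - rewrite sorted_map; apply: sub_sorted (sorted_enum_ord _) => a b ab /=.
      by have /forallP/(_ b)/implyP := fi a; apply.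
    - exact: sorted_filter (@ltn_ord_trans n) _ _ (sorted_enum_ord n).
    by move=> i; rewrite mem_filter mem_enum andbT.
  rewrite /order_iso size_map sl eqxx /=.
  apply/forallP => a; apply/forallP => b; have /forallP/(_ b) := fo a.
  have e (c : 'I_(size tau)) : nth 0 [seq val (s i) | i <- l] c = s (f c).
    rewrite (nth_map (f c)) ?sl //.
    by rewrite /l (nth_map c) ?size_enum_ord // nth_ord_enum.
  by rewrite !e.
case/subseqP => m; rewrite size_word => sm -> /andP[].
rewrite -map_mask size_map => sl /forallP fo.
set l := mask m (enum 'I_n) in sl fo.
have l_sorted : sorted (fun i j : 'I_n => i < j) l.
  exact: sorted_mask (@ltn_ord_trans n) _ _ (sorted_enum_ord n).
have e (a : 'I_(size tau)) x0 : nth x0 l a = tnth (Tuple sl) a.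
  by rewrite (tnth_nth x0).
exists [ffun a => tnth (Tuple sl) a]; apply/andP; split.
  apply/forallP => a; apply/forallP => b; apply/implyP => ab.
  have x0 : 'I_n := tnth (Tuple sl) a.
  rewrite !ffunE -!(e _ x0).
  by apply: (sorted_ltn_nth (@ltn_ord_trans n)); rewrite ?inE ?(eqP sl).
apply/forallP => a; apply/forallP => b; have /forallP/(_ b) := fo a.
have x0 : 'I_n := tnth (Tuple sl) a.
by rewrite !(nth_map x0) ?(eqP sl) // !e !ffunE.
Qed.

Lemma eq_occurs (Q1 Q2 : pred (seq nat)) : Q1 =1 Q2 -> occurs Q1 =1 occurs Q2.
Proof. by move=> e w; apply: eq_existsb => m; apply: e. Qed.

Lemma order_isoP tau u : reflect
  (size u = size tau /\ forall a b, a < size tau -> b < size tau ->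
     (nth 0 u a < nth 0 u b) = (nth 0 tau a < nth 0 tau b))
  (order_iso tau u).
Proof.
apply: (iffP andP) => [[/eqP su H]|[su H]]; last first.
  by split; [apply/eqP|apply/forallP => a; apply/forallP => b; rewrite H].
split=> // a b la lb; have /forallP/(_ (Ordinal la))/forallP := H.
by move/(_ (Ordinal lb))/eqP.
Qed.

Lemma order_iso132 : order_iso pattern132 =1 is132.
Proof.
move=> u; apply/order_isoP/idP => [[]|].
  case: u => [|x [|y [|z []]]] //= _ H.
  by rewrite (H 0 2) // (H 2 1).
case: u => [|x [|y [|z []]]] //= /andP[xz zy]; split=> //.
by move=> [|[|[|a]]] [|[|[|b]]] //= _ _; lia.
Qed.

Lemma ltn_nth_sorted s i j : sorted ltn s -> i < size s -> j < size s ->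
  (nth 0 s i < nth 0 s j) = (i < j).
Proof.
move=> ss li lj; have h := sorted_ltn_nth ltn_trans 0 ss.
case: (ltngtP i j) => [ij|ji|->]; last by rewrite ltnn.
  by apply: h.
by apply/negbTE; rewrite -leqNgt ltnW //; apply: h.
Qed.

Lemma order_iso2134 k : order_iso (pattern2134 k) =1 is2134 (k - 2).
Proof.
move=> u; rewrite /pattern2134; move: (k - 2) => r.
apply/order_isoP/idP => [[]|].
  case: u => [|x [|y l]] //=; rewrite size_iota => -[sl] H.
  rewrite sl eqxx (H 1 0) //=; apply/(pathP 0) => -[|i] lt_i /=.
    by rewrite (H 0 2) /= ?nth_iota -?sl.
  by rewrite (H i.+2 i.+3) /= ?nth_iota -?sl //; apply: ltnW.
case: u => [|x [|y l]] //= /and3P[/eqP sl yx pl].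
rewrite size_iota sl; split=> // a b la lb.
(* [sw] exchanges positions 0 and 1. Read through it, both words become increasing, and comparing
   letters amounts to comparing positions. *)
pose sw i := if i is i'.+2 then i else 1 - i.
have sw_lt i : i < r.+2 -> sw i < r.+2 by case: i => [|[]].
have nsw p q t i : nth 0 [:: p, q & t] i = nth 0 [:: q, p & t] (sw i).
  by case: i => [|[]].
rewrite !(nsw x) !(nsw 2) !ltn_nth_sorted ?sw_lt //= ?size_iota ?sw_lt //.
- by rewrite -[path _ _ _]/(sorted ltn (iota 2 r.+1)) iota_ltn_sorted.
- by rewrite yx.
- by rewrite sl sw_lt.
by rewrite sl sw_lt.
Qed.

Lemma avoiding_word k n (s : 'S_n) : avoiding (k - 2) (word s) =
  avoids pattern132 s && avoids (pattern2134 k) s.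
Proof.
rewrite /avoids !containsE (eq_occurs order_iso132).
by rewrite (eq_occurs (order_iso2134 k)).
Qed.

Lemma Ie_involutions k n : Ie (pattern2134 k) n =
  size [seq w <- involutions (k - 2) n | ~~ odd (word_inversions w)].
Proof.
rewrite /Ie cardE -(size_map (@word n)); apply: perm_size.
apply: uniq_perm; first by rewrite map_inj_uniq ?enum_uniq //; exact: word_injective.
  by rewrite filter_uniq // involutions_uniq.
move=> w; rewrite mem_filter mem_involutions.
have E (s : 'S_n) : (s \in [set s : 'S_n | [&& even_involution s,
      avoids pattern132 s & avoids (pattern2134 k) s]]) =
    [&& ~~ odd (word_inversions (word s)), avoiding (k - 2) (word s)
      & word_inv (word s) == word s].
  rewrite inE /even_involution avoiding_word card_inversions -word_permV.
  rewrite (inj_eq (@word_injective n)) (eq_sym _ s).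
  by case: (s == _); rewrite ?andbT ?andbF.
apply/mapP/and5P => [[s]|[od pw /eqP sw av iw]].
  rewrite mem_enum E => /and3P[od av iw] ->.
  by rewrite perm_word_word size_word.
have [s e] := word_surjective pw sw.
by exists s; rewrite // mem_enum E e od av iw.
Qed.

(** * Signed enumeration *)

Local Open Scope ring_scope.

Definition avoider_count (r n : nat) : rat := (size (avoiders r n))%:R.

Definition signed_count (s : rat) (r n : nat) : rat :=
  \sum_(w <- involutions r n) s ^+ word_inversions w.

Lemma avoider_count0 n : avoider_count 0 n = 1.
Proof. by rewrite /avoider_count (perm_size (avoiders0 n)). Qed.

Lemma avoider_countS0 r : avoider_count r 0 = 1.
Proof. by rewrite /avoider_count avoidersS0. Qed.

Lemma avoider_count_rec r n : avoider_count r.+1 n.+1 =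
  \sum_(i < n.+1) avoider_count r i * avoider_count r.+1 (n - i).
Proof.
rewrite /avoider_count (perm_size (avoiders_rec r n)) size_allpairs_dep.
rewrite sumnE big_map -[X in iota 0 X]subn0 -/(index_iota _ _) big_mkord natr_sum.
by apply: eq_bigr => i _; rewrite size_allpairs natrM.
Qed.

Lemma signed_count0 s n : signed_count s 0 n = 1.
Proof.
rewrite /signed_count (perm_big _ (involutions0 n)) big_seq1.
by rewrite word_inversions_iota.
Qed.

Lemma signed_countS0 s r : signed_count s r 0 = 1.
Proof. by rewrite /signed_count involutionsS0 big_seq1. Qed.

Lemma expr_sign_odd (s : rat) m n : s ^+ 2 = 1 -> odd m = odd n ->
  s ^+ m = s ^+ n.
Proof.
move=> s2 e; have h i : s ^+ i = s ^+ odd i.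
  by rewrite -{1}(odd_double_half i) exprD -mul2n exprM s2 expr1n mulr1.
by rewrite h e -h.
Qed.

(** The square (i + 1)^2 has the parity of i + 1 and the doubled terms drop out, so a [sym_node] has
    the sign of [g] times [s ^+ i.+1]. The sum over [u] is therefore a plain count. *)
Lemma signed_count_rec s r n : s ^+ 2 = 1 -> signed_count s r.+1 n.+1 =
  signed_count s r n + \sum_(0 <= i < n.+1./2)
    s ^+ i.+1 * avoider_count r i * signed_count s r.+1 (n.+1 - i.+1.*2).
Proof.
move=> s2; rewrite /signed_count (perm_big _ (involutions_rec r n)) big_cat /=.
rewrite big_map; congr (_ + _).
  rewrite big_seq [RHS]big_seq; apply: eq_bigr => w.
  by rewrite mem_involutions => /andP[pw _]; rewrite word_inversions_add_max.
rewrite big_allpairs_dep /index_iota subn0; apply: eq_bigr => i _.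
rewrite big_allpairs_dep /avoider_count -sum1_size natr_sum.
rewrite [s ^+ _ * _]mulr_sumr mulr_suml big_seq [RHS]big_seq; apply: eq_bigr => u.
rewrite mem_avoiders => /and3P[pu /eqP su au].
rewrite mulr1 mulr_sumr big_seq [RHS]big_seq; apply: eq_bigr => g.
rewrite mem_involutions -exprD => /andP[pg _] /=.
rewrite (word_inversions_sym_node pu pg au) su; apply: expr_sign_odd => //.
by rewrite !oddD odd_double oddM addbF andbb addbC.
Qed.

Lemma Ie_signed_count k n : (Ie (pattern2134 k) n)%:R =
  2%:R^-1 * (signed_count 1 (k - 2) n + signed_count (-1) (k - 2) n).
Proof.
rewrite Ie_involutions -sum1_size natr_sum big_filter big_mkcond /=.
rewrite /signed_count -big_split mulr_sumr; apply: eq_bigr => w _ /=.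
by rewrite expr1n -signr_odd; case: odd.
Qed.

(** * Generating functions *)

Definition conv (a b : nat -> rat) (n : nat) : rat :=
  \sum_(i < n.+1) a i * b (n - i)%N.

Definition trunc (N : nat) (a : nat -> rat) : {poly rat} := \poly_(i < N) a i.

(** A coefficient of a Cauchy product sees only finitely many terms, so the ring laws for [conv] are
    inherited from polynomials. *)
Lemma conv_trunc N a b n : (n < N)%N ->
  conv a b n = (trunc N a * trunc N b)`_n.
Proof.
move=> nN; rewrite coefM; apply: eq_bigr => i _; rewrite !coef_poly.
by rewrite (leq_ltn_trans (leq_subr _ _) nN) (leq_ltn_trans _ nN) // -ltnS.
Qed.

Lemma eq_conv a a' b b' : a =1 a' -> b =1 b' -> conv a b =1 conv a' b'.
Proof. by move=> ea eb n; apply: eq_bigr => i _; rewrite ea eb. Qed.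

Lemma convC a b : conv a b =1 conv b a.
Proof. by move=> n; rewrite !(@conv_trunc n.+1) // mulrC. Qed.

Lemma convA a b c : conv a (conv b c) =1 conv (conv a b) c.
Proof.
move=> n; transitivity ((trunc n.+1 a * (trunc n.+1 b * trunc n.+1 c))`_n).
  rewrite coefM; apply: eq_bigr => i _; rewrite coef_poly ltn_ord.
  by rewrite (@conv_trunc n.+1) // ltnS leq_subr.
rewrite mulrA coefM; apply: eq_bigr => i _; rewrite coef_poly ltnS leq_subr.
by rewrite (@conv_trunc n.+1).
Qed.

Lemma convBl a b c n :
  conv (fun i => a i - b i) c n = conv a c n - conv b c n.
Proof. by rewrite /conv -sumrB; apply: eq_bigr => i _; rewrite mulrBl. Qed.

Lemma convBr a b c n :
  conv a (fun i => b i - c i) n = conv a b n - conv a c n.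
Proof. by rewrite /conv -sumrB; apply: eq_bigr => i _; rewrite mulrBr. Qed.

Lemma convDr a b c n :
  conv a (fun i => b i + c i) n = conv a b n + conv a c n.
Proof. by rewrite /conv -big_split; apply: eq_bigr => i _; rewrite mulrDr. Qed.

Lemma conv_coefM (p q : {poly rat}) : conv (nth 0 p) (nth 0 q) =1 nth 0 (p * q).
Proof. by move=> n; rewrite coefM. Qed.

Lemma conv_mulp (p q : {poly rat}) a :
  conv (nth 0 (p * q)) a =1 conv (nth 0 p) (conv (nth 0 q) a).
Proof.
by move=> n; rewrite convA; apply: eq_conv => // i; rewrite conv_coefM.
Qed.

Lemma conv1 a : conv (nth 0 (1 : {poly rat})) a =1 a.
Proof.
move=> n; rewrite /conv big_ord_recl coef1 mul1r subn0 big1 ?addr0 // => i _.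
by rewrite coef1 mul0r.
Qed.

Lemma convXn m a n :
  conv (nth 0 ('X^m : {poly rat})) a n = if (n < m)%N then 0 else a (n - m)%N.
Proof.
rewrite (@conv_trunc (m + n).+1) ?ltnS ?leq_addl //.
have -> : trunc (m + n).+1 (nth 0 ('X^m : {poly rat})) = 'X^m.
  apply/polyP => i; rewrite coef_poly coefXn; case: ltnP => // le_i.
  by case: eqP => // ei; move: le_i; rewrite ei ltnNge leq_addr.
rewrite coefXnM coef_poly; case: ltnP => // _.
by rewrite (leq_ltn_trans (leq_subr _ _)) // ltnS leq_addl.
Qed.

Lemma eq_gen_fun a b f : a =1 b -> is_gen_fun a f -> is_gen_fun b f.
Proof.
move=> e [p [q [q0 ef H]]]; exists p, q; split=> // n.
by rewrite -H; apply: eq_bigr => i _; rewrite e.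
Qed.

Lemma gen_fun_poly (p : {poly rat}) : is_gen_fun (nth 0 p) (frac_of p).
Proof.
exists p, 1; split; first exact: oner_neq0.
  by rewrite /frac_of tofrac1 divr1.
exact: conv1.
Qed.

Lemma gen_fun_mulp (p : {poly rat}) a f :
  is_gen_fun a f -> is_gen_fun (conv (nth 0 p) a) (frac_of p * f).
Proof.
case=> p' [q [q0 -> H]]; exists (p * p'), q; split=> // [|n].
  by rewrite /frac_of tofracM mulrA.
rewrite -/(conv _ _ n) convA (eq_conv (convC _ _) (frefl _)) -convA.
by rewrite (eq_conv (frefl _) H) conv_coefM.
Qed.

Lemma gen_fun_add a b f g : is_gen_fun a f -> is_gen_fun b g ->
  is_gen_fun (fun n => a n + b n) (f + g).
Proof.
case=> p [q [q0 -> H]] [p' [q' [q0' -> H']]].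
exists (p * q' + p' * q), (q * q'); split=> [||n].
- by rewrite mulf_neq0.
- rewrite /frac_of tofracM tofracD !tofracM addf_div ?tofrac_eq0 //.
rewrite -/(conv (nth 0 (q * q')) (fun i => a i + b i) n) convDr coefD.
congr (_ + _).
  rewrite mulrC conv_mulp (eq_conv (frefl _) H) conv_coefM.
  by rewrite mulrC.
by rewrite conv_mulp (eq_conv (frefl _) H') conv_coefM mulrC.
Qed.

Lemma gen_fun_scale c a f : is_gen_fun a f ->
  is_gen_fun (fun n => c * a n) (const_ratfun c * f).
Proof.
move=> /(gen_fun_mulp c%:P); apply: eq_gen_fun => n.
rewrite /conv big_ord_recl coefC subn0 big1 ?addr0 // => i _.
by rewrite coefC mul0r.
Qed.

(** Solves B = h + f B. With f = p/q the equation reads (q - p) B = q h, and q - p is nonzero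
    because 1 - f is. *)
Lemma gen_fun_fix a b g f h : is_gen_fun a f -> is_gen_fun g h -> 1 - f != 0 ->
  (forall n, b n = g n + conv a b n) -> is_gen_fun b (h / (1 - f)).
Proof.
case=> p [q [q0 -> H]] [p' [q' [q0' -> H']]] f1 E.
have fq0 : frac_of q != 0 by rewrite frac_of_neq0.
have e1 : 1 - frac_of p / frac_of q = frac_of (q - p) / frac_of q.
  by rewrite -(divff fq0) -mulrBl /frac_of tofracB.
have qp0 : q - p != 0.
  by apply: contraNneq f1 => e; rewrite e1 e /frac_of tofrac0 mul0r.
exists (q * p'), (q' * (q - p)); split=> [||n]; first by rewrite mulf_neq0.
  by rewrite e1 invf_div mulf_div /frac_of !tofracM; congr (_ / _); apply: mulrC.
rewrite -/(conv _ _ n) conv_mulp.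
have E2 : conv (nth 0 (q - p)) b =1 conv (nth 0 q) g.
  move=> m; transitivity (conv (nth 0 q) b m - conv (nth 0 p) b m).
    by rewrite -convBl; apply: eq_conv => // i; rewrite coefB.
  rewrite -(eq_conv H (frefl b)) -convA -convBr; apply: eq_conv => // i.
  by rewrite E addrK.
rewrite (eq_conv (frefl _) E2) convA (eq_conv (convC _ _) (frefl _)) -convA.
by rewrite (eq_conv (frefl _) H') conv_coefM.
Qed.

(* The coefficients of a(s x^2). *)
Definition dilate (s : rat) (a : nat -> rat) (n : nat) : rat :=
  if odd n then 0 else s ^+ n./2 * a n./2.

Lemma coef_comp_dilate s (p : {poly rat}) :
  nth 0 (p \Po (s *: 'X^2)) =1 dilate s (nth 0 p).
Proof.
move=> n; rewrite comp_polyE coef_sum.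
under eq_bigr do rewrite exprZn -exprM scalerA coefZ coefXn.
rewrite /dilate; case: (boolP (odd n)) => [on|en].
  rewrite big1 // => i _; case: eqP => [e|_]; last by rewrite mulr0.
  by move: on; rewrite e oddM.
have n2 (i : nat) : (n == 2 * i)%N = (i == n./2)%N.
  by rewrite -[in LHS](odd_double_half n) (negbTE en) -mul2n eqn_mul2l eq_sym.
have [lt_n|le_n] := ltnP n./2 (size p); last first.
  rewrite [p`__]nth_default // mulr0 big1 // => i _.
  by rewrite n2 ltn_eqF ?mulr0 // (leq_trans (ltn_ord i)).
rewrite (bigD1 (Ordinal lt_n)) //= n2 eqxx mulr1 mulrC big1 ?addr0 // => i ni.
by rewrite n2 -[n./2]/(val (Ordinal lt_n)) val_eqE (negbTE ni) mulr0.
Qed.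

(** On truncations, dilation is composition with [s *: 'X^2], which respects products. *)
Lemma conv_dilate s a b : conv (dilate s a) (dilate s b) =1 dilate s (conv a b).
Proof.
move=> n; have e c (i : nat) : (i < n.+1)%N ->
    dilate s c i = (trunc n.+1 c \Po (s *: 'X^2))`_i.
  by move=> lin; rewrite coef_comp_dilate /dilate coef_poly (_ : (i./2 < n.+1)%N) //; lia.
transitivity (((trunc n.+1 a * trunc n.+1 b) \Po (s *: 'X^2))`_n).
  rewrite comp_polyM coefM; apply: eq_bigr => i _.
  by rewrite !e // ltnS leq_subr.
by rewrite coef_comp_dilate /dilate -conv_trunc //; lia.
Qed.

Lemma gen_fun_dilate s a f : s != 0 -> is_gen_fun a f ->
  is_gen_fun (dilate s a) (ratfun_at f (frac_of (s *: 'X^2))).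
Proof.
move=> s0 [p [q [q0 -> H]]].
have s2 : (1 < size (s *: 'X^2 : {poly rat}))%N by rewrite size_scale // size_polyXn.
exists (p \Po (s *: 'X^2)), (q \Po (s *: 'X^2)); split=> [||n].
- by rewrite comp_poly_eq0.
- by rewrite ratfun_atE ?poly_at_comp // => g; apply: poly_at_neq0.
rewrite -/(conv _ _ n) (eq_conv (coef_comp_dilate s q) (frefl _)) conv_dilate.
by rewrite coef_comp_dilate /dilate /conv H.
Qed.

(** * Generating functions of avoiders and of signed involutions *)

Lemma Rk_neq0 m : Rk m.+1 != 0.
Proof. by rewrite Rk_chebP mulf_neq0 ?invr_eq0 ?frac_of_neq0 ?chebP_neq0. Qed.

Lemma one_sub_varx_Rk_neq0 m : 1 - varx * Rk m.+1 != 0.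
Proof. by rewrite -invr_eq0 -Rk_rec Rk_neq0. Qed.

(** Cutting at the maximum gives A_k = 1 + x A_(k-1) A_k, which is the recursion of R_k; at k = 2
    there is one word of each length, and the series is 1/(1 - x) = R_2. *)
Lemma gen_fun_avoider_count r : is_gen_fun (avoider_count r) (Rk r.+2).
Proof.
elim: r => [|r IH]; rewrite Rk_rec -[_^-1]mul1r.
  rewrite Rk1 mulr1; have x1 := one_sub_varx_Rk_neq0 0.
  rewrite Rk1 mulr1 in x1.
  apply: (gen_fun_fix (gen_fun_poly 'X) (gen_fun_poly 1)) => // -[|n].
    by rewrite avoider_count0 coef1 -['X]expr1 convXn addr0.
  by rewrite !avoider_count0 coef1 -['X]expr1 convXn add0r avoider_count0.
have x1 := one_sub_varx_Rk_neq0 r.+1.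
apply: (gen_fun_fix (gen_fun_mulp 'X IH) (gen_fun_poly 1)) => // -[|n].
  by rewrite avoider_countS0 coef1 -convA -['X]expr1 convXn addr0.
rewrite avoider_count_rec coef1 -convA -['X]expr1 convXn add0r subn1.
by [].
Qed.

Lemma frac_of_sqr s : frac_of (s *: 'X^2) = const_ratfun s * varx ^+ 2.
Proof. by rewrite -mul_polyC /frac_of tofracM /varx /frac_of -tofracXn. Qed.

Lemma ratfun_at_Rk m (h : {poly rat}) : (1 < size h)%N -> ratfun_at (Rk m.+1) (frac_of h) =
  poly_at (chebP m) (frac_of h) / poly_at (chebP m.+1) (frac_of h).
Proof.
move=> h1; rewrite Rk_chebP ratfun_atE ?chebP_neq0 // => g.
exact: poly_at_neq0.
Qed.

Lemma div_sub_mul (F : fieldType) (y a b : F) : b != 0 ->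
  b / (b - y * a) = (1 - y * (a / b))^-1.
Proof.
by move=> b0; rewrite -[LHS]invf_div mulrBl divff // mulrA.
Qed.

Lemma poly_at_chebP_rec m y :
  poly_at (chebP m.+2) y = poly_at (chebP m.+1) y - y * poly_at (chebP m) y.
Proof. by rewrite /poly_at [chebP m.+2]/= rmorphB rmorphM /= map_polyX !hornerE. Qed.

Lemma ratfun_at_Rk_rec m (h : {poly rat}) : (1 < size h)%N ->
  ratfun_at (Rk m.+2) (frac_of h) =
    (1 - frac_of h * ratfun_at (Rk m.+1) (frac_of h))^-1.
Proof.
move=> h1; have n0 : poly_at (chebP m.+1) (frac_of h) != 0.
  by rewrite poly_at_neq0 ?chebP_neq0.
(* A plain rewrite would also try to convert Rk m.+1 to Rk m.+2, by unfolding
   xchoose. *)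
apply: etrans (ratfun_at_Rk m.+1 h1) _.
rewrite (ratfun_at_Rk m h1) poly_at_chebP_rec.
by rewrite div_sub_mul.
Qed.

Lemma sum_even (F : nat -> rat) N :
  \sum_(j < N) (if odd j then 0 else F j./2) = \sum_(0 <= i < uphalf N) F i.
Proof.
elim: N => [|N IH]; first by rewrite big_ord0 big_nil.
rewrite big_ord_recr /= IH uphalf_half; case: (boolP (odd N)) => _ /=.
  by rewrite addr0.
by rewrite add0n big_nat_recr.
Qed.

(** The solved form of the recursion for G_k with k = r + 2. At k = 2 only identities remain, all of
    them even, so both signs start from R_2. *)
Fixpoint signed_gen (s : rat) (r : nat) : ratfun :=
  if r is r1.+1 then
    (1 + varx * signed_gen s r1) * ratfun_at (Rk r.+2) (frac_of (s *: 'X^2))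
  else Rk 2.

Lemma gen_fun_signed_count s r : s ^+ 2 = 1 ->
  is_gen_fun (signed_count s r) (signed_gen s r).
Proof.
move=> s2; have s0 : s != 0 by rewrite -sqrf_eq0 s2 oner_neq0.
have h1 : (1 < size (s *: 'X^2 : {poly rat}))%N by rewrite size_scale // size_polyXn.
elim: r => [|r IH].
  apply: eq_gen_fun (gen_fun_avoider_count 0) => n.
  by rewrite avoider_count0 signed_count0.
rewrite /= ratfun_at_Rk_rec //; apply: gen_fun_fix.
- exact: gen_fun_mulp (gen_fun_dilate s0 (gen_fun_avoider_count r)).
- exact: gen_fun_add (gen_fun_poly 1) (gen_fun_mulp 'X IH).
- rewrite -invr_eq0 -ratfun_at_Rk_rec // ratfun_at_Rk //.
  by rewrite mulf_neq0 ?invr_eq0 ?poly_at_neq0 ?chebP_neq0.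
have e (a : nat -> rat) n :
    conv (nth 0 (s *: 'X^2 : {poly rat})) a n = s * conv (nth 0 ('X^2 : {poly rat})) a n.
  by rewrite /conv mulr_sumr; apply: eq_bigr => i _; rewrite coefZ mulrA.
case=> [|n]; rewrite -convA e -['X]expr1 !convXn coef1.
  by rewrite signed_countS0 mulr0 !addr0.
rewrite signed_count_rec // add0r subn1 /=; congr (_ + _).
case: n => [|n] /=; first by rewrite big_nil mulr0.
(* The prefactor s x^2 removes one factor [s] and two letters, so term i of the recursion becomes
   the term of index 2i in a Cauchy product of total degree [n]; the terms of odd index vanish. *)
pose F i := s ^+ i * avoider_count r i * signed_count s r.+1 (n - i.*2)%N.
rewrite subn2 /=.
have -> : conv (dilate s (avoider_count r)) (signed_count s r.+1) n =
    \sum_(j < n.+1) (if odd j then 0 else F j./2).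
  apply: eq_bigr => j _; rewrite /dilate /F; case: (boolP (odd j)) => oj.
    by rewrite mul0r.
  by rewrite -[X in (n - X)%N]odd_double_half (negbTE oj).
rewrite sum_even mulr_sumr; apply: eq_bigr => i _.
by rewrite /F exprS !mulrA doubleS subSS subSS.
Qed.

(** * The closed form *)

Lemma chebU_neq0 m : chebU m (2%:R * varx)^-1 != 0.
Proof.
have := varx_sqr_neq0 (chebP_neq0 m); rewrite poly_at_chebP.
by rewrite mulf_eq0 negb_or => /andP[].
Qed.

Lemma partial_sum_ratio (F : fieldType) (x u u' S : F) :
    x != 0 -> u != 0 -> u' != 0 ->
  (x * u')^-1 * (S + u) = (1 + x * ((x * u)^-1 * S)) * (u / (x * u')).
Proof. by move=> x0 u0 u0'; field; rewrite x0 u0 u0'. Qed.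

(** Splitting off the last summand U_m exhibits the factor U_m/(x U_(m+1)), which is R_(m+1)(x^2).
    This is the recursion of [signed_gen] at s = 1. *)
Lemma Fm_rec m : (0 < m)%N ->
  Fm m.+1 = (1 + varx * Fm m) * ratfun_at (Rk m.+1) (varx ^+ 2).
Proof.
move=> m0; rewrite RkE // /Fm big_nat_recr // -[m.+1.-1]/m.
exact: partial_sum_ratio varx_neq0 (chebU_neq0 m) (chebU_neq0 m.+1).
Qed.

Lemma varx_sqrE : varx ^+ 2 = frac_of (1 *: 'X^2).
Proof. by rewrite frac_of_sqr rmorph1 mul1r. Qed.

Lemma oppr_varx_sqrE : - varx ^+ 2 = frac_of (- 1 *: 'X^2).
Proof. by rewrite frac_of_sqr rmorphN1 mulN1r. Qed.

Lemma size_scaleX2 (s : rat) : s != 0 -> (1 < size (s *: 'X^2 : {poly rat}))%N.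
Proof. by move=> s0; rewrite size_scale // size_polyXn. Qed.

Lemma ratfun_at_Rk_rec1 r : ratfun_at (Rk r.+2) (varx ^+ 2) =
  (1 - varx ^+ 2 * ratfun_at (Rk r.+1) (varx ^+ 2))^-1.
Proof. by rewrite varx_sqrE; apply/ratfun_at_Rk_rec/size_scaleX2. Qed.

Lemma ratfun_at_Rk_recN1 r : ratfun_at (Rk r.+2) (- varx ^+ 2) =
  (1 + varx ^+ 2 * ratfun_at (Rk r.+1) (- varx ^+ 2))^-1.
Proof.
have N10 : - 1 != 0 :> rat by rewrite oppr_eq0 oner_neq0.
have h := ratfun_at_Rk_rec r (size_scaleX2 N10).
rewrite -oppr_varx_sqrE in h; apply: etrans h _.
by rewrite mulNr opprK.
Qed.

Lemma ratfun_at_Rk_neq0 r (h : {poly rat}) :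
  (1 < size h)%N -> ratfun_at (Rk r.+1) (frac_of h) != 0.
Proof.
move=> h1; rewrite ratfun_at_Rk // mulf_neq0 ?invr_eq0 //;
  by rewrite poly_at_neq0 ?chebP_neq0.
Qed.

Lemma denom_rec1_neq0 r :
  1 - varx ^+ 2 * ratfun_at (Rk r.+1) (varx ^+ 2) != 0.
Proof.
rewrite -invr_eq0 -ratfun_at_Rk_rec1 varx_sqrE.
exact/ratfun_at_Rk_neq0/size_scaleX2.
Qed.

Lemma denom_recN1_neq0 r :
  1 + varx ^+ 2 * ratfun_at (Rk r.+1) (- varx ^+ 2) != 0.
Proof.
rewrite -invr_eq0 -ratfun_at_Rk_recN1 oppr_varx_sqrE.
by apply/ratfun_at_Rk_neq0/size_scaleX2; rewrite oppr_eq0 oner_neq0.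
Qed.

(** The identity F_2(x) = (1 + x) R_2(x^2) = R_2(x) that starts the comparison of F_k with G_k^+.
    The factors [* 1] stand where the values of F_1 and R_1 occur. *)
Lemma Rk2_eq (F : fieldType) (x : F) : 1 - x ^+ 2 != 0 ->
  (1 + x * 1) * (1 - x ^+ 2 * 1)^-1 = (1 - x * 1)^-1.
Proof.
rewrite !mulr1 -[X in X - _](expr1n _ 2) subr_sqr mulf_eq0 negb_or.
by case/andP => x1 x2; field; rewrite x1 x2.
Qed.

Lemma ratfun_at1 (h : {poly rat}) : (1 < size h)%N ->
  ratfun_at (Rk 1) (frac_of h) = 1.
Proof.
by move=> h1; rewrite ratfun_at_Rk // divff // poly_at_neq0 ?oner_neq0.
Qed.

Lemma Fm_signed_gen r : Fm r.+2 = signed_gen 1 r.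
Proof.
elim: r => [|r IH]; last by rewrite Fm_rec // IH /= -varx_sqrE.
have A1 : ratfun_at (Rk 1) (varx ^+ 2) = 1.
  by rewrite varx_sqrE ratfun_at1 ?size_scaleX2.
have F1 : Fm 1 = 1 by rewrite -A1 RkE // /Fm big_nat1 mulrC.
rewrite (Fm_rec (ltn0Sn 0)) F1 ratfun_at_Rk_rec1 A1 /= Rk_rec Rk1.
by apply: Rk2_eq; have := denom_rec1_neq0 0; rewrite A1 mulr1.
Qed.

Lemma half_addf_div (F : fieldType) (a b c d : F) : b != 0 -> d != 0 ->
  2%:R^-1 * (a / b + c / d) = (a * d + c * b) / (2%:R * (b * d)).
Proof. by move=> b0 d0; rewrite addf_div // [in RHS]invfM mulrCA. Qed.

(** [ratfun_at] evaluates a chosen representative, so it is not additive by construction. The mean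
    is first written as a single fraction of polynomials, to which [ratfun_atE] applies. *)
Lemma ratfun_at_Rke m : ratfun_at (Rke m.+1) (varx ^+ 2) =
  2%:R^-1 * (ratfun_at (Rk m.+1) (varx ^+ 2) + ratfun_at (Rk m.+1) (- varx ^+ 2)).
Proof.
have sX : (1 < size (- 'X : {poly rat}))%N by rewrite size_polyN size_polyX.
have oppX : - varx = frac_of (- 'X) by rewrite /frac_of tofracN.
pose p := chebP m; pose q := chebP m.+1; pose p' := p \Po - 'X; pose q' := q \Po - 'X.
have q0 : q != 0 := chebP_neq0 _.
have q0' : q' != 0 by rewrite comp_poly_eq0.
have two0 : (2%:R%:P : {poly rat}) != 0 by rewrite polyC_eq0.
have E : Rke m.+1 = frac_of (p * q' + p' * q) / frac_of (2%:R%:P * (q * q')).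
  rewrite /Rke oppX (ratfun_at_Rk m sX) Rk_chebP !poly_at_comp.
  rewrite half_addf_div ?frac_of_neq0 //; congr (_ / _).
    by rewrite /frac_of tofracD !tofracM.
  rewrite /frac_of !tofracM; congr (_ * _).
  by rewrite -[LHS](rmorph_nat const_ratfun).
have flip g : poly_at (g \Po - 'X) (varx ^+ 2) = poly_at g (- varx ^+ 2).
  rewrite oppr_varx_sqrE varx_sqrE !poly_at_comp -comp_polyA.
  by rewrite raddfN /= comp_polyX scaleN1r scale1r.
have n0 (g : {poly rat}) : g != 0 -> poly_at g (varx ^+ 2) != 0.
  exact: varx_sqr_neq0.
rewrite E (ratfun_atE _ n0) ?mulf_neq0 // oppr_varx_sqrE varx_sqrE.
rewrite (ratfun_at_Rk m (size_scaleX2 (oner_neq0 _))).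
have N10 : - 1 != 0 :> rat by rewrite oppr_eq0 oner_neq0.
rewrite (ratfun_at_Rk m (size_scaleX2 N10)) -varx_sqrE -oppr_varx_sqrE.
rewrite -!flip half_addf_div ?n0 // !poly_atM; congr (_ / (_ * _)).
  by rewrite -!poly_atM /poly_at rmorphD /= hornerD.
by rewrite /poly_at map_polyC hornerC /= rmorph_nat.
Qed.

(** From 1/B - 1/A = x^2 (a + b) follows A - B = x^2 (a + b) A B. Replacing A by B + (A - B) in the
    first summand makes B a common factor and leaves the correction in (1 + x u) A, which will be
    F_k. *)
Lemma mean_step (F : fieldType) (x a b u v A B : F) :
    2%:R != 0 :> F -> 1 - x ^+ 2 * a != 0 -> 1 + x ^+ 2 * b != 0 ->
    A = (1 - x ^+ 2 * a)^-1 -> B = (1 + x ^+ 2 * b)^-1 ->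
  2%:R^-1 * ((1 + x * u) * A + (1 + x * v) * B)
  = (1 + x ^+ 2 * (2%:R^-1 * (a + b)) * ((1 + x * u) * A)
     + x * (2%:R^-1 * (u + v))) * B.
Proof. by move=> two0 a0 b0 -> ->; field; rewrite two0 a0 b0. Qed.

Definition mean_gen (r : nat) : ratfun :=
  2%:R^-1 * (signed_gen 1 r + signed_gen (-1) r).

Lemma mean_gen_rec r : mean_gen r.+1 =
  (1 + varx ^+ 2 * ratfun_at (Rke r.+2) (varx ^+ 2) * Fm r.+3
   + varx * mean_gen r) * ratfun_at (Rk r.+3) (- varx ^+ 2).
Proof.
rewrite /mean_gen Fm_signed_gen ratfun_at_Rke /= -varx_sqrE -oppr_varx_sqrE.
exact: mean_step two_neq0 (denom_rec1_neq0 _) (denom_recN1_neq0 _)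
  (ratfun_at_Rk_rec1 _) (ratfun_at_Rk_recN1 _).
Qed.

(** The summand of index j is created at level [r.+2 - j] together with the factor B of that level,
    and gains x and one more factor B at each of the j later levels. *)
Lemma unroll_rec (F : fieldType) (x : F) (B : nat -> F) (T : nat -> nat -> F)
    (E : nat -> F) :
    (forall r, E r.+1 = (T r.+2 r.+3 + x * E r) * B r.+3) ->
  forall r, E r = \sum_(0 <= j < r)
      (x ^+ j * T (r.+2 - 1 - j)%N (r.+2 - j)%N
       * \prod_(r.+2 - j <= i < r.+3) B i)
    + x ^+ r * E 0%N * \prod_(3 <= i < r.+3) B i.
Proof.
move=> Erec; elim=> [|r IH].
  by rewrite !big_geq // add0r expr0 mul1r mulr1.
rewrite Erec IH [\sum_(0 <= j < r.+1) _]big_nat_recl //.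
rewrite !subn0 big_nat1 expr0 mul1r.
rewrite [\prod_(3 <= i < r.+4) _]big_nat_recr //=.
have -> : \sum_(0 <= j < r) x ^+ j.+1 * T (r.+3 - 1 - j.+1)%N (r.+3 - j.+1)%N
      * \prod_(r.+3 - j.+1 <= i < r.+4) B i
    = x * (\sum_(0 <= j < r) x ^+ j * T (r.+2 - 1 - j)%N (r.+2 - j)%N
      * \prod_(r.+2 - j <= i < r.+3) B i) * B r.+3.
  rewrite mulr_sumr mulr_suml; apply: eq_bigr => j _.
  rewrite !subn1 /= !subSS big_nat_recr /=; last by rewrite ltnW // ltnS leq_subr.
  by rewrite exprS !mulrA.
by rewrite exprS subn1 /=; ring.
Qed.

Theorem theorem3p7 (k : nat) (hk : (2 <= k)%N) :
  is_gen_fun (fun n : nat => (Ie (pattern2134 k) n)%:R)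
    (\sum_(0 <= j < k - 2)
        (varx ^+ j
         * (1 + varx ^+ 2 * ratfun_at (Rke (k - 1 - j)) (varx ^+ 2) * Fm (k - j))
         * \prod_(k - j <= i < k.+1) ratfun_at (Rk i) (- varx ^+ 2))
     + varx ^+ (k - 2) * Rk 2
       * \prod_(3 <= j < k.+1) ratfun_at (Rk j) (- varx ^+ 2)).
Proof.
have N1sqr : (- 1) ^+ 2 = 1 :> rat by rewrite sqrrN expr1n.
have G := gen_fun_scale 2%:R^-1 (gen_fun_add
  (gen_fun_signed_count (k - 2) (expr1n _ 2))
  (gen_fun_signed_count (k - 2) N1sqr)).
have := eq_gen_fun (fun n => esym (Ie_signed_count k n)) G.
rewrite fmorphV rmorph_nat -/(mean_gen _).
have [r -> {hk G}] : exists r, k = r.+2.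
  by case: k hk {G} => [|[|r]] //; exists r.
rewrite (_ : r.+2 - 2 = r)%N; last by rewrite subn2.
rewrite (unroll_rec (x := varx) (E := mean_gen)
  (B := fun i => ratfun_at (Rk i) (- varx ^+ 2))
  (T := fun i m => 1 + varx ^+ 2 * ratfun_at (Rke i) (varx ^+ 2) * Fm m)
  mean_gen_rec).
have -> // : mean_gen 0 = Rk 2.
by rewrite /mean_gen /= -mulr2n -[Rk 2 *+ 2]mulr_natl mulKf ?two_neq0.
Qed.
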